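(* Let $p$ be a prime, let $k$ be an algebraically closed field of characteristic $p$, let $G$ be a finite group, and let $B$ be a block algebra of $kG$ having a nontrivial defect group and a unique isomorphism class of simple modules. Then $\dim_k(HH^1(B))\geq 2$.
   Context: For a finite-dimensional associative unital $k$-algebra $A$, $HH^1(A)=\mathrm{Der}(A)/\mathrm{IDer}(A)$, where $\mathrm{Der}(A)$ is the space of $k$-linear maps $f:A\to A$ with $f(ab)=f(a)b+af(b)$ for all $a,b\in A$, and $\mathrm{IDer}(A)$ is the subspace of inner derivations $a\mapsto ca-ac$, with $c\in A$. A block algebra of $kG$ is an algebra $B=kGb$, where $b$ is a primitive idempotent of the centre $Z(kG)$. For a $p$-subgroup $Q$ of $G$, the Brauer homomorphism $\mathrm{Br}_Q:(kG)^Q\to kC_G(Q)$ is the restriction to $Q$-fixed points (under conjugation) of the linear projection $kG\to kC_G(Q)$ sending elements of $G\setminus C_G(Q)$ to $0$. A defect group of $B$ is a $p$-subgroup $P$ of $G$ maximal with respect to $\mathrm{Br}_P(b)\neq 0$; it is unique up to $G$-conjugation. *)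

(* Defs.v *)
From HB Require Import structures.
From mathcomp Require Import all_boot all_order all_fingroup all_algebra.
From mathcomp Require Import all_solvable all_field.

Set Implicit Arguments.
Unset Strict Implicit.
Unset Printing Implicit Defensive.

Import GRing.Theory.
Local Open Scope quotient_scope.
Local Open Scope ring_scope.

(* The quotient V / W of a finite-dimensional space V by a subspace W; it is  *)
(* identified with the complement W^C to obtain coordinates.                  *)

Section QuotientSpace.
Import VectorInternalTheory.
Variables (K : fieldType) (V : vectType K) (W : {vspace V}).

Definition quotv : Type := {ideal_quot (W : {pred V})}.

HB.instance Definition _ := GRing.Zmodule.on quotv.

Definition piv (x : V) : quotv := \pi_{ideal_quot (W : {pred V})} x.
Definition reprv (q : quotv) : V :=
  generic_quotient.repr (q : {ideal_quot (W : {pred V})}).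

Lemma piv_eq x y : (piv x == piv y) = (x - y \in W).
Proof. by rewrite (Quotient.idealrBE (W : {pred V})). Qed.

Lemma pivD x y : piv (x + y) = piv x + piv y.
Proof. exact: (@Quotient.pi_add V W). Qed.

Lemma reprvK : cancel reprv piv.
Proof. by move=> q; apply: reprK. Qed.

Definition scalev (a : K) (q : quotv) : quotv := piv (a *: reprv q).

Lemma pivZ a x : piv (a *: x) = scalev a (piv x).
Proof. by apply/eqP; rewrite piv_eq -scalerBr memvZ // -piv_eq reprvK. Qed.

Fact scalevA a b q : scalev a (scalev b q) = scalev (a * b) q.
Proof. by rewrite -[q]reprvK -!pivZ scalerA. Qed.
Fact scale1v : left_id 1 scalev.
Proof. by move=> q; rewrite -[q]reprvK -!pivZ scale1r. Qed.
Fact scalevDr : right_distributive scalev +%R.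
Proof.
by move=> a q r; rewrite -[q]reprvK -[r]reprvK -pivD -!pivZ -pivD scalerDr.
Qed.
Fact scalevDl q : {morph scalev^~ q : a b / a + b}.
Proof. by move=> a b; rewrite -[q]reprvK -!pivZ -pivD scalerDl. Qed.

HB.instance Definition _ :=
  GRing.Zmodule_isLmodule.Build K quotv scalevA scale1v scalevDr scalevDl.

Fact piv_is_linear : linear piv.
Proof. by move=> a x y; rewrite pivD pivZ. Qed.
HB.instance Definition _ := GRing.isSemilinear.Build K V quotv _ piv
  (GRing.semilinear_linear piv_is_linear).

Lemma piv_eq0 x : (piv x == 0) = (x \in W).
Proof. by rewrite -(linear0 piv) piv_eq subr0. Qed.

Let proj (x : V) : V := x - projv W x.
Let coordv (q : quotv) : 'rV[K]_(dim (subvs_of W^C)) :=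
  v2r (vsproj W^C (proj (reprv q))).

Let coordvE x : coordv (piv x) = v2r (vsproj W^C (proj x)).
Proof.
rewrite /coordv; set y := reprv _; congr (v2r (vsproj _ _)).
have Wyx : y - x \in W by rewrite -piv_eq reprvK.
by rewrite /proj -[y](subrK x) linearD /= (projv_id Wyx) opprD addrACA subrr add0r.
Qed.

Fact quotv_vector : Vector.axiom (dim (subvs_of W^C)) quotv.
Proof.
exists coordv.
  move=> a q r; rewrite -[q]reprvK -[r]reprvK -linearP !coordvE -!linearP.
  by congr (v2r (vsproj _ _)); rewrite /proj linearP opprD scalerBr addrACA.
exists (fun r => piv (vsval (r2v r))) => [q | r].
  rewrite -{2}[q]reprvK v2rK vsprojK ?memv_projC //; apply/eqP.
  by rewrite piv_eq addrC addKr rpredN memv_proj.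
rewrite coordvE; set w := r2v r; have Ww : vsval w \in W^C%VS := subvsP w.
have /eqP w0 : projv W (vsval w) == 0 by rewrite -memv_ker lker_proj.
by rewrite /proj w0 subr0 vsvalK r2vK.
Qed.
HB.instance Definition _ :=
  Lmodule_hasFinDim.Build K quotv quotv_vector.

Lemma dim_quotv : \dim {: quotv} = (\dim {: V} - \dim W)%N.
Proof. by rewrite dimvf -dimv_compl; apply: erefl. Qed.

End QuotientSpace.

Section Hochschild.
Variables (K : fieldType) (A : falgType K).
Implicit Types f : 'End(A).

Definition derivation f : Prop :=
  forall a b : A, f (a * b) = f a * b + a * f b.

Definition leibniz_defect (a b : A) f : A := f (a * b) - (f a * b + a * f b).

Fact leibniz_defect_is_linear a b : linear (leibniz_defect a b).
Proof.
move=> c f g; rewrite /leibniz_defect !add_lfunE !scale_lfunE.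
rewrite mulrDl mulrDr -scalerAl -scalerAr scalerBr scalerDr.
by rewrite [c *: _ + _ + (_ + _)]addrACA opprD addrACA.
Qed.
HB.instance Definition _ a b :=
  GRing.isSemilinear.Build K 'End(A) A _ (leibniz_defect a b)
    (GRing.semilinear_linear (leibniz_defect_is_linear a b)).

(* The Leibniz rule is bilinear in (a, b), so it is enough to impose it on a  *)
(* basis; see memv_Der.                                                       *)
Definition Der : {vspace 'End(A)} :=
  let e i := tnth (vbasis {: A}) i in
  (\bigcap_i \bigcap_j lker (linfun (leibniz_defect (e i) (e j))))%VS.

Lemma memv_Der f : f \in Der <-> derivation f.
Proof.
split=> [Df a b | Df].
  have De i j : leibniz_defect (vbasis {: A})`_i (vbasis {: A})`_j f = 0.
    have [lti | gei] := ltnP i (\dim {: A}); last first.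
      rewrite /leibniz_defect [(vbasis _)`_i]nth_default ?size_tuple //.
      by rewrite !mul0r linear0 !mul0r addr0 subrr.
    have [ltj | gej] := ltnP j (\dim {: A}); last first.
      rewrite /leibniz_defect [(vbasis _)`_j]nth_default ?size_tuple //.
      by rewrite !mulr0 linear0 !mulr0 addr0 subrr.
    have: f \in lker (linfun (leibniz_defect
      (tnth (vbasis {: A}) (Ordinal lti)) (tnth (vbasis {: A}) (Ordinal ltj)))).
      apply: subvP f Df; apply: subv_trans (bigcapv_inf (Ordinal lti) _ _) _ => //.
      exact: (bigcapv_inf (Ordinal ltj)).
    by rewrite memv_ker lfunE /= !(tnth_nth 0) => /eqP.
  have{}De i j := subr0_eq (De i j).
  have{}De i c : f ((vbasis {: A})`_i * c)
      = f (vbasis {: A})`_i * c + (vbasis {: A})`_i * f c.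
    rewrite (coord_vbasis (memvf c)) mulr_sumr !linear_sum /= !mulr_sumr.
    rewrite -big_split; apply: eq_bigr => j _ /=.
    by rewrite -scalerAr !linearZ /= De -!scalerAr scalerDr.
  rewrite (coord_vbasis (memvf a)) mulr_suml !linear_sum /= !mulr_suml.
  rewrite -big_split; apply: eq_bigr => i _ /=.
  by rewrite -scalerAl !linearZ /= De -!scalerAl scalerDr.
rewrite memvE; apply/subv_bigcapP => i _; apply/subv_bigcapP => j _.
by rewrite -memvE memv_ker lfunE /= /leibniz_defect Df subrr.
Qed.

Definition inner_der (c : A) : 'End(A) := amull c - amulr c.

Lemma inner_derE c a : inner_der c a = c * a - a * c.
Proof. by rewrite add_lfunE opp_lfunE !lfunE. Qed.

Fact inner_der_is_linear : linear inner_der.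
Proof.
by move=> k c d; rewrite /inner_der (linearP (@amull K A)) (linearP (@amulr K A)) scalerBr opprD addrACA.
Qed.
HB.instance Definition _ := GRing.isSemilinear.Build K A 'End(A) _ inner_der
  (GRing.semilinear_linear inner_der_is_linear).

Definition IDer : {vspace 'End(A)} := limg (linfun inner_der).

Lemma memv_IDer f : f \in IDer <-> exists c, f = inner_der c.
Proof.
split=> [/memv_imgP[c _ ->] | [c ->]]; first by exists c; rewrite lfunE.
by rewrite -[inner_der c](lfunE inner_der) memv_img ?memvf.
Qed.

Lemma IDer_sub_Der : (IDer <= Der)%VS.
Proof.
apply/subvP=> f /memv_IDer[c ->]; apply/memv_Der => a b.
by rewrite !inner_derE mulrBl mulrBr !mulrA addrA subrK.
Qed.

Definition HH1 : Type :=
  quotv (linfun (vsval : subvs_of Der -> 'End(A)) @^-1: IDer)%VS.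

HB.instance Definition _ := Vector.on HH1.

Lemma dim_HH1 : \dim {: HH1} = (\dim Der - \dim IDer)%N.
Proof.
set g := linfun (vsval : subvs_of Der -> 'End(A)).
have imgDer : limg g = Der.
  apply/vspaceP=> f; apply/memv_imgP/idP => [[d _ ->] | Df].
    by rewrite lfunE subvsP.
  by exists (vsproj Der f); rewrite ?memvf // lfunE /= vsprojK.
have g_inj : lker g == 0%VS.
  by apply/lker0P => d e; rewrite !lfunE; apply: val_inj.
have preimK : (g @: (g @^-1: IDer))%VS = IDer.
  by apply: lpreimK; rewrite imgDer IDer_sub_Der.
have dimg U : \dim (g @: U) = \dim U.
  by rewrite limg_dim_eq // (eqP g_inj) capv0.
by rewrite -[in \dim Der]imgDer -[in \dim IDer]preimK !dimg; exact: dim_quotv.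
Qed.

End Hochschild.

Section Modules.
Variable A : nzRingType.

Definition simple_module (V : lmodType A) : Prop :=
  (exists v : V, v != 0) /\
  forall S : {pred V}, GRing.submod_closed S -> S =i pred1 0 \/ S =i predT.

Definition iso_module (V W : lmodType A) : Prop :=
  exists f : {linear V -> W}, bijective f.

Definition unique_simple_module : Prop :=
  exists V : lmodType A, simple_module V /\
    forall W : lmodType A, simple_module W -> iso_module V W.

End Modules.

(* Elements of k[gT] are written as functions on the group, the function x    *)
(* standing for the sum of the x g *: g.                                      *)

Section GroupAlgebra.
Variables (k : fieldType) (gT : finGroupType).

Definition galg : Type := {ffun gT -> k}.

HB.instance Definition _ := Vector.copy galg {ffun gT -> k^o}.

Implicit Types x y z : galg.

Definition galg_of (g : gT) : galg := [ffun h => (h == g)%:R].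
Definition galg_one : galg := galg_of 1%g.
Definition galg_mul x y : galg :=
  [ffun g => \sum_h x h * y (h^-1 * g)%g].

Fact galg_mulA : associative galg_mul.
Proof.
move=> x y z; apply/ffunP => g; rewrite !ffunE.
under eq_bigr do rewrite ffunE mulr_sumr.
under [RHS]eq_bigr do rewrite ffunE mulr_suml.
rewrite [RHS]exchange_big; apply: eq_bigr => h _ /=.
rewrite [RHS](reindex_inj (mulgI h)) /=; apply: eq_bigr => u _.
by rewrite mulrA mulKg invMg mulgA.
Qed.
Fact galg_mul1l : left_id galg_one galg_mul.
Proof.
move=> x; apply/ffunP => g; rewrite ffunE (bigD1 1%g) //= big1 => [|h /negPf].
  by rewrite ffunE eqxx mul1r invg1 mul1g addr0.
by rewrite ffunE => ->; rewrite mul0r.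
Qed.
Fact galg_mul1r : right_id galg_one galg_mul.
Proof.
move=> x; apply/ffunP => g; rewrite ffunE (bigD1 g) //= big1 => [|h neq].
  by rewrite ffunE mulVg eqxx mulr1 addr0.
by rewrite ffunE -eq_mulVg1 (negPf neq) mulr0.
Qed.
Fact galg_mulDl : left_distributive galg_mul +%R.
Proof.
move=> x y z; apply/ffunP => g; rewrite !ffunE -big_split.
by apply: eq_bigr => h _; rewrite !ffunE mulrDl.
Qed.
Fact galg_mulDr : right_distributive galg_mul +%R.
Proof.
move=> x y z; apply/ffunP => g; rewrite !ffunE -big_split.
by apply: eq_bigr => h _; rewrite !ffunE mulrDr.
Qed.
Fact galg_one_neq0 : galg_one != 0.
Proof.
by apply/eqP => /ffunP/(_ 1%g); rewrite !ffunE eqxx => /eqP; rewrite oner_eq0.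
Qed.

HB.instance Definition _ := GRing.Zmodule_isNzRing.Build galg
  galg_mulA galg_mul1l galg_mul1r galg_mulDl galg_mulDr galg_one_neq0.

Fact galg_scaleAl (a : k) x y : a *: (x * y) = (a *: x) * y.
Proof.
apply/ffunP => g; rewrite !ffunE scaler_sumr.
by apply: eq_bigr => h _; rewrite ffunE; apply: mulrA.
Qed.
HB.instance Definition _ := GRing.Lmodule_isLalgebra.Build k galg galg_scaleAl.

Fact galg_scaleAr (a : k) x y : a *: (x * y) = x * (a *: y).
Proof.
apply/ffunP => g; rewrite !ffunE scaler_sumr.
by apply: eq_bigr => h _; rewrite ffunE; apply: mulrCA.
Qed.
HB.instance Definition _ := GRing.Lalgebra_isAlgebra.Build k galg galg_scaleAr.
HB.instance Definition _ := Algebra_isFalgebra.Build k galg.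

Lemma galg_ofM g h : galg_of (g * h)%g = galg_of g * galg_of h.
Proof.
apply/ffunP => u; rewrite !ffunE (bigD1 g) //= big1 => [|v /negPf].
  by rewrite !ffunE eqxx mul1r addr0 -[in RHS](inj_eq (mulgI g)) mulKVg.
by rewrite ffunE => ->; rewrite mul0r.
Qed.

(* The projection of kG onto kC_G(Q) along the span of G \ C_G(Q), with       *)
(* kC_G(Q) viewed inside kG; its restriction to the Q-fixed points is Br_Q.   *)
Definition brauer (Q : {set gT}) x : galg :=
  [ffun g => if g \in 'C(Q)%g then x g else 0].

End GroupAlgebra.

Section Blocks.
Variables (k : fieldType) (gT : finGroupType).
Implicit Types (b : galg k gT) (P : {group gT}).

(* Products commute in the centre, so one orthogonality condition suffices.   *)
Definition block_idempotent b : Prop :=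
  [/\ b \in 'Z({: galg k gT})%VS, b * b = b, b != 0
    & forall e f, e \in 'Z({: galg k gT})%VS -> f \in 'Z({: galg k gT})%VS ->
        e * e = e -> f * f = f -> e * f = 0 -> b = e + f -> e = 0 \/ f = 0].

Fact block_algebra_subproof b :
  block_idempotent b -> is_aspace ({: galg k gT} * <[b]>)%VS.
Proof.
case=> Zb bb b0 _.
have cb x : x * b = b * x.
  by move: Zb; rewrite memv_cap => /andP[_ /centvP ->] //; apply: memvf.
rewrite -limg_amulr; apply/andP; split.
  apply/has_algidP; exists b; split=> //.
    by apply/memv_imgP; exists 1; rewrite ?memvf // lfunE /= mul1r.
  move=> _ /memv_imgP[x _ ->]; rewrite lfunE /= -mulrA bb; split=> //.
  by rewrite mulrA -cb -mulrA bb.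
apply/prodvP => _ _ /memv_imgP[x _ ->] /memv_imgP[y _ ->].
apply/memv_imgP; exists (x * b * y); first exact: memvf.
by rewrite !lfunE /= !mulrA.
Qed.

(* B = kGb, with identity b; as an algebra in its own right, subvs_of B.      *)
Definition block_algebra b (hb : block_idempotent b) : {aspace galg k gT} :=
  ASpace (block_algebra_subproof hb).

Definition defect_group (p : nat) b P : bool :=
  [max P | p.-group P & (brauer P b != 0)%R]%g.

End Blocks.

(* Main.v *)
(** The form [t x = x 1] makes [B] a symmetric algebra.  Since all primitive
    idempotents of [B] are equivalent, [B] is a matrix algebra over the local
    symmetric algebra [A = eBe], and outer derivations of [A] extend to outer
    derivations of [B].  Let [J] be the radical of [A].  If [dim J/J^2 >= 2],
    two independent functionals on [J/J^2] give derivations of [A] into its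
    socle, and these are not inner because [t] vanishes on commutators but not
    on the socle.  If [dim J/J^2 = 1], then [A = k[x]/(x^n)], and multiples of
    [d/dx] are enough unless [n = 2 <> 0] in [k].

    There remain [A = k] and [A = k + kx] with [x^2 = 0], [2 <> 0].  Then the
    image of the relative trace [y |-> sum_g g y g^-1] on [B] contains [b],
    respectively the socle element [X] corresponding to [x], and elements of
    that image vanish at every [g] with [p] dividing [|C(g)|].  In the second
    case [b(g)] is a multiple of [X(g)] when [g] is [p]-regular, because
    [y = b g^-1] satisfies [y^(p^n) = y], and [b(g) = 0] when [g] is
    [p]-singular, by Osima's theorem.  Either way [b] vanishes on [C(P)] for
    each nontrivial [p]-subgroup [P], i.e. [Br_P(b) = 0]. *)

Require Import Defs.
From HB Require Import structures.
From mathcomp Require Import all_boot all_order all_fingroup all_algebra.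
From mathcomp Require Import all_solvable all_field.
From Stdlib Require Import Classical.

Set Implicit Arguments.
Unset Strict Implicit.
Unset Printing Implicit Defensive.

Import GRing.Theory.
Local Open Scope ring_scope.

(** * Local algebras *)

(** One more power of [x] than the dimension allows cannot be linearly independent. *)
Lemma annihilating_poly (K : fieldType) (A : falgType K) (x : A) :
  exists2 p : {poly K}, p != 0 & horner_alg x p = 0.
Proof.
apply: NNPP => no_p; pose X := [tuple x ^+ i | i < (\dim {: A}).+1].
suff /eqP dimX: free X.
  by have := dimvS (subvf <<X>>); rewrite dimX size_tuple ltnn.
apply/freeP => a aX i; apply/eqP/negPn/negP => ai; case: no_p.
pose p := \poly_(i < (\dim {: A}).+1) oapp a 0 (insub i).
exists p; first by apply: contraNneq ai => /polyP/(_ i);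
  rewrite coef_poly ltn_ord valK coef0 => /= ->.
rewrite /p poly_def rmorph_sum /= -[RHS]aX; apply: eq_bigr => j _.
by rewrite (nth_map ord0) ?size_enum_ord // valK /= -mul_polyC rmorphM rmorphXn
  /= horner_algC horner_algX mulr_algl nth_ord_enum.
Qed.

(** The linear factors of an annihilating polynomial are applied to [1] one after another; the last
    nonzero value is an eigenvector. *)
Lemma exists_eigenvector (K : closedFieldType) (A : falgType K) (x : A) :
  exists2 w : A, w != 0 & exists a, (x - a%:A) * w = 0.
Proof.
have [p p0 px] := annihilating_poly x.
have [r Dp] := closed_field_poly_normal p.
suff IH w : w != 0 -> (\prod_(z <- r) (x - z%:A)) * w = 0 ->
    exists2 w', w' != 0 & exists a, (x - a%:A) * w' = 0.
  apply: (IH 1); rewrite ?oner_eq0 ?mulr1 //.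
  move: px; rewrite Dp -mul_polyC rmorphM rmorph_prod /= horner_algC mulr_algl
    => /eqP.
  rewrite scaler_eq0 lead_coef_eq0 (negPf p0) => /eqP <-.
  by apply: eq_bigr => z _; rewrite rmorphB /= horner_algX horner_algC.
elim/last_ind: r {p0 px Dp} w => [|r a IHr] w w0.
  by rewrite big_nil mul1r => /eqP; rewrite (negPf w0).
rewrite -cats1 big_cat big_seq1 /= -mulrA => rw.
have [aw | aw] := eqVneq ((x - a%:A) * w) 0; first by exists w => //; exists a.
exact: IHr rw.
Qed.

(** Let [y = x - a] kill [w != 0]. An annihilating polynomial [X^n q] of [y] with [q(0) != 0] gives,
    by Bezout, the idempotent [(u X^n)(y)]. It is not [1] because [y w = 0], so it is [0], and then
    [y^n = 0]. *)
Lemma local_eigenvalue (K : closedFieldType) (A : falgType K) :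
    (forall f : A, f * f = f -> f = 0 \/ f = 1) ->
  forall x : A, exists a n, (x - a%:A) ^+ n = 0.
Proof.
move=> triv_idem x; have [w w0 [a xw]] := exists_eigenvector x.
exists a; move: (x - _) xw => y yw.
have [p p0 py] := annihilating_poly y.
(* The extra factor ['X] makes the multiplicity [n] of the root 0 positive. *)
have [n [q]] := multiplicity_XsubC (p * 'X) 0.
rewrite mulf_neq0 ?polyX_eq0 //= subr0 => q0 Dp.
have n_gt0: (0 < n)%N.
  case: n Dp => // Dp; case/negP: q0.
  by rewrite -[q]mulr1 -(expr0 'X) -Dp rootM rootX eqxx orbT.
have /Bezout_eq1_coprimepP[[u v] /= uv]: coprimep ('X ^+ n) q.
  by apply: coprimep_expl; rewrite -['X]subr0 coprimep_sym coprimep_XsubC.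
have ev0 : horner_alg y ('X ^+ n * q) = 0.
  by rewrite mulrC -Dp rmorphM /= py mul0r.
have evXn : horner_alg y ('X ^+ n) = y ^+ n by rewrite rmorphXn /= horner_algX.
have orth : horner_alg y (u * 'X ^+ n) * horner_alg y (v * q) = 0.
  by rewrite -rmorphM mulrACA rmorphM /= ev0 mulr0.
have sum1 : horner_alg y (u * 'X ^+ n) + horner_alg y (v * q) = 1 by rewrite
  -rmorphD uv rmorph1.
have [| f0 | f1] := triv_idem (horner_alg y (u * 'X ^+ n)).
- by rewrite -[RHS]mulr1 -sum1 mulrDr orth addr0.
- exists n; rewrite -[LHS]mulr1 -sum1 f0 add0r -evXn -rmorphM mulrCA rmorphM /=.
  by rewrite ev0 mulr0.
case/eqP: w0; rewrite -[w]mul1r -f1 rmorphM /= evXn -(prednK n_gt0) exprSr.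
by rewrite -!mulrA yw !mulr0.
Qed.

Lemma exists_argmin (T : Type) (Q : T -> Prop) (f : T -> nat) :
  (exists x, Q x) -> exists2 x, Q x & forall y, Q y -> (f x <= f y)%N.
Proof.
move=> [x Qx]; have [n] := ubnP (f x); elim: n => // n IHn in x Qx *.
move=> le_fx; apply: NNPP => no_min; case: (no_min); exists x => // y Qy.
rewrite leqNgt; apply/negP => lt_yx; apply: no_min.
exact: IHn Qy (leq_trans lt_yx _).
Qed.

(** A subspace of maximal dimension inside [Q] absorbs every [x] with [Q x], since adjoining the
    line of [x] stays inside [Q]. This makes a subspace out of a predicate, such as nilpotency, that
    comes with no decision procedure. *)
Lemma vspace_of_predicate (K : fieldType) (V : vectType K) (Q : V -> Prop) :
    Q 0 -> (forall a x y, Q x -> Q y -> Q (a *: x + y)) ->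
  exists U : {vspace V}, forall x, x \in U <-> Q x.
Proof.
move=> Q0 QL; pose sub (U : {vspace V}) := forall x, x \in U -> Q x.
have [|U QU maxU] := @exists_argmin _ sub (fun U => \dim {: V} - \dim U)%N.
  by exists 0%VS => x; rewrite memv0 => /eqP->.
exists U => x; split=> [/QU // | Qx].
have /maxU: sub (U + <[x]>)%VS.
  move=> _ /memv_addP[u Uu [_ /vlineP[a ->] ->]]; rewrite addrC.
  exact: QL Qx (QU u Uu).
rewrite leq_sub2lE; last exact: dimvS (subvf _).
rewrite (geq_leqif (dimv_leqif_sup (addvSl U _))) => /(subv_trans (addvSr U _)).
by rewrite -memvE.
Qed.

Lemma lfun_of_linear (K : fieldType) (U V : vectType K) (f : U -> V) :
  linear f -> exists F : 'Hom(U, V), F =1 f.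
Proof.
move=> lin_f.
pose fL : {linear U -> V} := HB.pack f
  (GRing.isSemilinear.Build K U V _ f (GRing.semilinear_linear lin_f)).
by exists (linfun fL) => u; rewrite lfunE.
Qed.

(** The map [1 - projv U] kills [U] but not [v]; [f] composes it with the coordinate along the image
    of [v]. *)
Lemma separating_functional (K : fieldType) (V : vectType K) (U : {vspace V}) v
  :
  v \notin U -> exists2 f : {scalar V}, {in U, forall u, f u = 0} & f v = 1.
Proof.
move=> notUv; pose g := (\1 - projv U)%VF; pose w := g v.
have w0 : w != 0.
  apply: contraNneq notUv => /eqP;
    rewrite /w /g add_lfunE opp_lfunE id_lfunE subr_eq0.
  by move/eqP->; apply: memv_proj.
pose X := [tuple w].
exists (coord X ord0 \o g) => /=.
  by move=> u Uu; rewrite /g add_lfunE opp_lfunE id_lfunE projv_id // subrr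
    linear0.
by rewrite -/w -[w in coord _ _ w]/(X`_(@ord0 0)) coord_free // seq1_free.
Qed.

(** * Algebras in which every element is a scalar plus a nilpotent *)

Section LocalAlgebra.
Variables (K : fieldType) (A : falgType K).
Implicit Types (x y z : A) (U V W : {vspace A}).

Definition nilpotent_elt x := exists n, x ^+ n = 0.

Lemma nilpotent_not_rinv x y : nilpotent_elt x -> x * y <> 1.
Proof.
move=> [n xn] xy; suff: x ^+ n * y ^+ n = 1.
  by move/eqP; rewrite xn mul0r eq_sym oner_eq0.
elim: n {xn} => [|n IHn]; first by rewrite mulr1.
by rewrite exprSr exprS mulrA -[_ * x * y]mulrA xy mulr1.
Qed.

Lemma nilpotent_mulC x y : nilpotent_elt (x * y) -> nilpotent_elt (y * x).
Proof.
move=> [n xyn]; exists n.+1; suff ->: (y * x) ^+ n.+1 = y * (x * y) ^+ n * x.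
  by rewrite xyn mulr0 mul0r.
elim: n {xyn} => [|n IHn]; first by rewrite mulr1.
by rewrite exprSr IHn exprSr !mulrA.
Qed.

(** [X + a] and [X^n] are coprime, so a Bezout relation evaluated at [x] yields an inverse. *)
Lemma unit_scalar_addr_nilpotent a x :
  a != 0 -> nilpotent_elt x -> a%:A + x \is a GRing.unit.
Proof.
move=> a0 [n xn]; have: coprimep ('X + a%:P) ('X ^+ n).
  apply: coprimep_expr; rewrite -[a]opprK polyCN coprimep_sym coprimep_XsubC.
  by rewrite rootE hornerX oppr_eq0.
case/Bezout_eq1_coprimepP=> [[u v] /= uv].
have hXn : horner_alg x ('X ^+ n) = 0 by rewrite rmorphXn /= horner_algX.
have: horner_alg x (u * ('X + a%:P)) = 1.
  have hv : horner_alg x (v * 'X ^+ n) = 0 by rewrite rmorphM /= hXn mulr0.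
  by rewrite -[RHS](rmorph1 (horner_alg x)) -uv rmorphD /= hv addr0.
rewrite [u * _]mulrC rmorphM => e1; move: (e1); rewrite -rmorphM mulrC rmorphM.
rewrite !rmorphD /= horner_algX horner_algC addrC in e1 * => e2.
by apply/unitrP; exists (horner_alg x u).
Qed.

Hypothesis local_eigen : forall x, exists a, nilpotent_elt (x - a%:A).

Lemma unit_or_nilpotent x : x \is a GRing.unit \/ nilpotent_elt x.
Proof.
have [a xa] := local_eigen x; have [a0 | a0] := eqVneq a 0.
  by right; rewrite a0 scale0r subr0 in xa.
by left; rewrite -[x](subrK a%:A) addrC unit_scalar_addr_nilpotent.
Qed.

Lemma nilpotent_not_unit x : nilpotent_elt x -> x \isn't a GRing.unit.
Proof. by move=> nx; apply/negP=> /mulrV; apply: nilpotent_not_rinv. Qed.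

Lemma nilpotent_mulr x y : nilpotent_elt x -> nilpotent_elt (x * y).
Proof.
move=> nx; have [/mulrV | //] := unit_or_nilpotent (x * y).
by rewrite -mulrA => /(nilpotent_not_rinv nx).
Qed.

Lemma nilpotent_mull x y : nilpotent_elt x -> nilpotent_elt (y * x).
Proof. by move=> nx; apply/nilpotent_mulC/nilpotent_mulr. Qed.

(** With [s = (x + y)^-1], the element [y s = 1 - x s] would be both nilpotent and a unit. *)
Lemma nilpotent_add x y :
  nilpotent_elt x -> nilpotent_elt y -> nilpotent_elt (x + y).
Proof.
move=> nx ny; have [Uxy | //] := unit_or_nilpotent (x + y).
have := nilpotent_mulr (x + y)^-1 ny.
have ->: y * (x + y)^-1 = 1 - x * (x + y)^-1.
  by apply/eqP; rewrite eq_sym subr_eq addrC -mulrDl mulrV.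
case/nilpotent_not_unit/negP; rewrite -mulrN -[1]scale1r.
apply: unit_scalar_addr_nilpotent (oner_neq0 K) _.
exact: nilpotent_mulr.
Qed.

Lemma exists_radical : exists J : {vspace A}, forall x, x \in J <->
  nilpotent_elt x.
Proof.
apply: vspace_of_predicate => [|a x y nx ny]; first by exists 1%N.
by apply: nilpotent_add => //; rewrite -mulr_algl; apply: nilpotent_mull.
Qed.

End LocalAlgebra.

(** The last clause is linear independence modulo inner derivations, phrased without the quotient so
    that it passes easily from a corner to the whole algebra. *)
Definition two_outer_derivations (K : fieldType) (A : falgType K) :=
  exists D1 D2 : 'End(A), [/\ derivation D1, derivation D2
    & forall a b c, a *: D1 + b *: D2 = inner_der c -> a = 0 /\ b = 0].

(** * Radical, socle and derivations of a local symmetric algebra *)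

Section LocalSymmetric.
Variables (K : fieldType) (A : falgType K).
Implicit Types (x y z : A) (U V W : {vspace A}).
Hypothesis local_eigen : forall x, exists a, nilpotent_elt (x - a%:A).
Variable J : {vspace A}.
Hypothesis memJ : forall x, x \in J <-> nilpotent_elt x.

Lemma radical_idealr : (J * fullv <= J)%VS.
Proof. by apply/prodvP=> x y /memJ nx _; apply/memJ/nilpotent_mulr. Qed.

Lemma radical_ideall : (fullv * J <= J)%VS.
Proof. by apply/prodvP=> x y _ /memJ ny; apply/memJ/nilpotent_mull. Qed.

Lemma radical_decomp x : exists a, exists2 j, j \in J & x = a%:A + j.
Proof.
have [a nx] := local_eigen x; exists a, (x - a%:A); first exact/memJ.
by rewrite addrC subrK.
Qed.

(** If [W != 0], take a proper left submodule [M] of maximal dimension and [w] in [W] outside it.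
    Then [W = Aw + M], so [W <= JW] lies in [Jw + M] and [w = jw + u] with [u] in [M]. As [1 - j] is
    a unit, [w] is in [M]. *)
Lemma nakayama W : (fullv * W <= W)%VS -> (W <= J * W)%VS -> W = 0%VS.
Proof.
move=> idW sWJ; apply/eqP/negPn/negP => W0.
pose Q U := [/\ (U <= W)%VS, U != W & (fullv * U <= U)%VS].
have [|M [sMW neqMW idM] maxM] := @exists_argmin _ Q (fun U => \dim W - \dim
  U)%N.
  by exists 0%VS; split; rewrite ?sub0v 1?eq_sym ?prodv0.
have [w Ww notMw]: exists2 w, w \in W & w \notin M.
  apply/subvPn; apply: contra neqMW => sWM; apply/eqP/eqP.
  by rewrite eqEsubv sMW.
have sMN: (M <= fullv * <[w]> + M)%VS by apply: addvSr.
have Nw : w \in (fullv * <[w]> + M)%VS.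
  by rewrite (subvP (addvSl _ _)) // -{1}[w]mul1r memv_mul ?memvf ?memv_line.
have sNW : (fullv * <[w]> + M <= W)%VS.
  by rewrite subv_add sMW andbT (subv_trans _ idW) // prodvSr -?memvE.
have DW : (fullv * <[w]> + M)%VS = W.
  apply: contraNeq notMw => neqNW.
  have /maxM: Q (fullv * <[w]> + M)%VS.
    split=> //.
    by rewrite prodvDr prodvA addvS // prodvSl ?subvf.
  rewrite leq_sub2lE; last exact: dimvS sNW.
  rewrite (geq_leqif (dimv_leqif_sup sMN)).
  by move/subvP/(_ w Nw).
have: w \in (J * <[w]> + M)%VS.
  apply: subvP Ww; apply: subv_trans sWJ _; rewrite -{1}DW prodvDr prodvA.
  by rewrite addvS ?prodvSl ?radical_idealr // (subv_trans _ idM) ?prodvSl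
    ?subvf.
case/memv_addP=> _ /[!(=^~ limg_amulr)] /memv_imgP[j Jj ->] [u Mu].
rewrite lfunE /= => Dw; case/negP: notMw.
have Uj : 1%:A - j \is a GRing.unit.
  by rewrite unit_scalar_addr_nilpotent ?oner_eq0 //; apply/memJ;
    rewrite rpredN.
rewrite -[w](mulKr Uj) (subvP idM) // memv_mul ?memvf //.
by rewrite mulrBl scale1r mul1r {1}Dw addrC addKr.
Qed.

Lemma radical_pow_ideal n : (fullv * J ^+ n.+1 <= J ^+ n.+1)%VS.
Proof. by rewrite expvSl prodvA prodvSl ?radical_ideall. Qed.

(** A power of minimal dimension is unchanged by multiplication with [J], so Nakayama's lemma kills
    it. *)
Lemma radical_nilpotent : exists n, (J ^+ n.+1 = 0)%VS.
Proof.
have [|n _ minn] := @exists_argmin nat (fun=> True) (fun n => \dim (J ^+ n.+1)).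
  by exists 0%N.
exists n; apply: nakayama; first exact: radical_pow_ideal.
have sJW : (J * J ^+ n.+1 <= J ^+ n.+1)%VS.
  exact: subv_trans (prodvSl _ (subvf J)) (radical_pow_ideal n).
have /= := minn n.+1 I; rewrite [(J ^+ n.+2)%VS]expvSl.
by rewrite (geq_leqif (dimv_leqif_sup sJW)).
Qed.

(** Any nonzero element of the last nonzero power of [J] will do. *)
Lemma exists_socle_elt : J != 0%VS ->
  exists2 z, z != 0 & forall j, j \in J -> j * z = 0 /\ z * j = 0.
Proof.
move=> J0; have [n0 Jn0] := radical_nilpotent.
have ex_n: exists n, (J ^+ n.+1 == 0)%VS by exists n0; apply/eqP.
case: (ex_minnP ex_n) => [[|n] /eqP Jn minn].
  by case/eqP: J0; rewrite -(expv1 J).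
have Jn_neq0 : (J ^+ n.+1 != 0)%VS by apply/negP => /minn; rewrite ltnn.
exists (vpick (J ^+ n.+1)%VS) => [|j Jj]; first by rewrite vpick0.
move: (vpick _) (memv_pick (J ^+ n.+1)%VS) => z Jz.
split; apply/eqP; rewrite -memv0 -Jn; first by rewrite expvSl memv_mul.
by rewrite expvSr memv_mul.
Qed.

Lemma radical_sq_proper : J != 0%VS -> exists2 x, x \in J & x \notin (J ^+
  2)%VS.
Proof.
move=> J0; apply/subvPn; apply: contra J0 => sJ; apply/eqP/nakayama => //.
exact: radical_ideall.
Qed.

Section Trace.
Variable t : {scalar A}.
Hypothesis t_sym : forall x y, t (x * y) = t (y * x).
Hypothesis t_nondeg : forall x, x != 0 -> exists y, t (x * y) != 0.

Lemma trace_inner c x : t (inner_der c x) = 0.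
Proof. by rewrite inner_derE linearB /= t_sym subrr. Qed.

(** For [x = a + i] and [y = b + j] with [i], [j] in [J], [f (x y) = a f(j) + b f(i)], while
    multiplication of [z] by [x] or [y] only sees the scalars [a] and [b]. *)
Lemma socle_derivation (f : {scalar A}) z :
    f 1 = 0 -> {in (J ^+ 2)%VS, forall w, f w = 0} ->
    (forall j, j \in J -> j * z = 0 /\ z * j = 0) ->
  exists2 D : 'End(A), derivation D & forall x, D x = f x *: z.
Proof.
move=> f1 fJ2 zJ; have [|D DE] := @lfun_of_linear K A A (fun x => f x *: z).
  by move=> a x y; rewrite linearP /= scalerDl scalerA.
exists D => // x y; rewrite !DE.
have [a [i Ji ->]] := radical_decomp x; have [b [j Jj ->]] := radical_decomp y.
have fij : f (i * j) = 0 by rewrite fJ2 // expv2 memv_mul.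
rewrite !mulrDl !mulrDr !linearD /= !mulr_algl !mulr_algr !linearZ /= f1 fij.
rewrite !mulr0 !add0r addr0 -!scalerAl -!scalerAr (zJ j Jj).2 (zJ i Ji).1.
by rewrite !scaler0 !addr0 scalerDl !scalerA [b * _]mulrC addrC [f i * b]mulrC
  [f j * a]mulrC.
Qed.

(** A scalar in [J] is zero. This allows a separating functional to vanish on [1] too, as
    [socle_derivation] requires. *)
Lemma radical_adjoin_one U u :
  (U <= J)%VS -> u \in J -> u \notin U -> u \notin (<[1]> + U)%VS.
Proof.
move=> /subvP sUJ Ju; apply: contra => /memv_addP[_ /vlineP[a ->] [w Uw Du]].
suff a0 : a = 0 by rewrite Du a0 scale0r add0r.
have: u - w \in J by rewrite rpredB // sUJ.
rewrite Du addrK => /memJ/nilpotent_not_unit; apply: contraNeq => a0.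
by rewrite -[_%:A]addr0 unit_scalar_addr_nilpotent //; exists 1%N.
Qed.

(* The trace form does not vanish on the socle but vanishes on commutators, so
   no derivation into the socle is inner. *)
Lemma two_generators_outer x y :
    x \in J -> y \in J -> x \notin (J ^+ 2)%VS -> y \notin (<[x]> + J ^+ 2)%VS
      ->
  two_outer_derivations A.
Proof.
move=> Jx Jy notJ2x notUy.
have J0 : J != 0%VS.
  by apply: contraNneq notJ2x => J0; move: Jx; rewrite J0 memv0 => /eqP->;
    apply: mem0v.
have [z z0 zJ] := exists_socle_elt J0.
(* Since [z J = 0], [t (z w)] is the scalar part of [w] times [t z]. *)
have tz : t z != 0.
  have [w] := t_nondeg z0; have [a [j Jj ->]] := radical_decomp w.
  by rewrite mulrDr (zJ j Jj).2 addr0 mulr_algr linearZ /= mulf_eq0 => /norP[].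
have J2J : (J ^+ 2 <= J)%VS.
  by rewrite expv2 (subv_trans (prodvSr _ (subvf _))) ?radical_idealr.
have notUx : x \notin (<[y]> + J ^+ 2)%VS.
  apply/negP => /memv_addP[_ /vlineP[a ->] [w J2w Dx]].
  have [a0 | a0] := eqVneq a 0.
    by case/negP: notJ2x; rewrite Dx a0 scale0r add0r.
  case/negP: notUy; apply/memv_addP; exists (a^-1 *: x);
    first by rewrite memvZ ?memv_line.
  exists (- a^-1 *: w); first by rewrite memvZ.
  by rewrite Dx scalerDr scalerA mulVf // scale1r scaleNr addrK.
have der_of u v : u \in J -> v \in J -> u \notin (<[v]> + J ^+ 2)%VS ->
    exists D : 'End(A), [/\ derivation D, D u = z & D v = 0].
  move=> Ju Jv notUu; have sUJ : (<[v]> + J ^+ 2 <= J)%VS.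
    by rewrite subv_add -memvE Jv J2J.
  have [f fU fu] := separating_functional (radical_adjoin_one sUJ Ju notUu).
  have [|w J2w|D derD DE] := @socle_derivation f z _ _ zJ.
  - by rewrite fU // (subvP (addvSl _ _)) ?memv_line.
  - by rewrite fU // (subvP (addvSr _ _)) // (subvP (addvSr _ _)).
  exists D; split=> //; first by rewrite DE fu scale1r.
  by rewrite DE fU ?scale0r // (subvP (addvSr _ _)) // (subvP (addvSl _ _))
    ?memv_line.
have [D1 [derD1 D1x D1y]] := der_of x y Jx Jy notUx.
have [D2 [derD2 D2y D2x]] := der_of y x Jy Jx notUy.
exists D1, D2; split=> // a b c DE; split; apply/eqP.
  have := trace_inner c x;
    rewrite -DE add_lfunE !scale_lfunE D1x D2x scaler0 addr0.
  by rewrite linearZ => /eqP; rewrite mulf_eq0 (negPf tz) orbF.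
have := trace_inner c y;
  rewrite -DE add_lfunE !scale_lfunE D1y D2y scaler0 add0r.
by rewrite linearZ => /eqP; rewrite mulf_eq0 (negPf tz) orbF.
Qed.

End Trace.

(** * Derivations of truncated polynomial algebras *)

Section OneGenerator.
Variable x : A.
Hypotheses (Jx : x \in J) (notJ2x : x \notin (J ^+ 2)%VS).
Hypothesis genJ : (J <= <[x]> + J ^+ 2)%VS.
Local Notation h := (horner_alg x).

Lemma one_generator_pow k : (J ^+ k.+1 <= <[x ^+ k.+1]> + J ^+ k.+2)%VS.
Proof.
elim: k => [|k IHk]; first by rewrite expv1 expr1.
have sx_J : (<[x]> <= J)%VS by rewrite -memvE.
rewrite [X in (X <= _)%VS]expvSl (subv_trans (prodvSl _ genJ)) //.
rewrite prodvDl subv_add -expvD addvSr andbT (subv_trans (prodvSr _ IHk)) //.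
by rewrite prodvDr prodv_line -exprS addvS // [X in (_ <= X)%VS]expvSl prodvSl.
Qed.

(** Correction by multiples of [x^(k+1)], layer by layer, ends because [J] is nilpotent. The boolean
    equality lets [xchoose] select a representing polynomial later. *)
Lemma one_generator_horner (a : A) : exists p, h p == a.
Proof.
have [n Jn] := radical_nilpotent.
have approx k b : b \in J -> exists p, b - h p \in (J ^+ k.+1)%VS.
  move=> Jb; elim: k => [|k [p Jk]]; first by exists 0;
    rewrite rmorph0 subr0 expv1.
  have /memv_addP[_ /vlineP[c ->] [w Jw Dw]] := subvP (one_generator_pow k) _
    Jk.
  exists (p + c *: 'X^(k.+1)); rewrite rmorphD -mul_polyC rmorphM rmorphXn /=.
  by rewrite horner_algC horner_algX mulr_algl opprD addrA Dw addrC addKr.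
have [c [j Jj ->]] := radical_decomp a; have [p] := approx n j Jj.
rewrite Jn memv0 subr_eq0 => /eqP jE; exists (c%:P + p).
by rewrite rmorphD /= horner_algC jE.
Qed.

Lemma one_generator_comm (a b : A) : a * b = b * a.
Proof.
have [p /eqP<-] := one_generator_horner a;
  have [q /eqP<-] := one_generator_horner b.
by rewrite -!rmorphM mulrC.
Qed.

Lemma horner_alg_unit (q : {poly K}) : ~~ root q 0 -> h q \is a GRing.unit.
Proof.
move=> q0; have /factor_theorem[s Ds] : root (q - q.[0]%:P) 0.
  by rewrite rootE hornerD hornerN hornerC subrr.
rewrite -[q](subrK q.[0]%:P) Ds subr0 rmorphD rmorphM /= horner_algX
  horner_algC.
rewrite addrC unit_scalar_addr_nilpotent //; apply: nilpotent_mull => //.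
exact/memJ.
Qed.

Variable m : nat.
Hypotheses (xm : x ^+ m = 0) (min_m : forall n, x ^+ n = 0 -> (m <= n)%N).

(** If [p = q X^i] with [q(0) != 0], then [q(x)] is a unit, so [x^i = 0] and [m <= i]. *)
Lemma horner_alg_ker p : h p = 0 -> 'X^m %| p.
Proof.
have [-> | p0 hp] := eqVneq p 0; first by rewrite dvdp0.
have [i [q]] := multiplicity_XsubC p 0; rewrite p0 subr0 /= => q0 Dp.
rewrite Dp dvdp_mull // dvdp_exp2l // min_m //.
apply: (mulrI (horner_alg_unit q0)); rewrite mulr0 -hp Dp rmorphM rmorphXn /=.
by rewrite horner_algX.
Qed.

(** The derivation [q d/dX] of the polynomial ring descends to the quotient by [X^m] as soon as it
    sends [X^m] into that ideal. *)
Lemma horner_derivation (q : {poly K}) : h (q * ('X^m)^`()) = 0 ->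
  exists2 D : 'End(A), derivation D & forall p, D (h p) = h (q * p^`()).
Proof.
move=> hq; pose rep a := xchoose (one_generator_horner a).
have repK a : h (rep a) = a by apply/eqP/(xchooseP (one_generator_horner a)).
have hXm : h 'X^m = 0 by rewrite rmorphXn /= horner_algX.
have well_def p p' : h p = h p' -> h (q * p^`()) = h (q * p'^`()).
  move=> /eqP; rewrite -subr_eq0 -rmorphB => /eqP/horner_alg_ker/dvdpP[s Ds].
  apply/eqP; rewrite -subr_eq0 -rmorphB -mulrBr -derivB Ds derivM mulrDr !mulrA.
  by rewrite rmorphD rmorphM /= hXm mulr0 add0r mulrAC rmorphM /= hq mul0r.
have [|D DE] := @lfun_of_linear K A A (fun a => h (q * (rep a)^`())).
  move=> a u v; have hZ p : a *: h p = h (a%:P * p).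
    by rewrite rmorphM /= horner_algC mulr_algl.
  rewrite hZ -rmorphD /= (well_def _ (a%:P * rep u + rep v)).
    by rewrite derivD derivM derivC mul0r add0r mulrDr mulrCA.
  by rewrite rmorphD /= -hZ !repK.
have Dh p : D (h p) = h (q * p^`()) by rewrite DE; apply: well_def.
exists D => // a b; rewrite -[a]repK -[b]repK -rmorphM !Dh derivM mulrDr
  rmorphD.
by rewrite -!rmorphM mulrA mulrCA.
Qed.

(** The algebra is commutative, so inner derivations vanish; evaluation at [x] recovers [h q1] and
    [h q2]. *)
Lemma two_outer_of_polys (q1 q2 : {poly K}) :
    h (q1 * ('X^m)^`()) = 0 -> h (q2 * ('X^m)^`()) = 0 ->
    (forall a b, a *: h q1 + b *: h q2 = 0 -> a = 0 /\ b = 0) ->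
  two_outer_derivations A.
Proof.
move=> /horner_derivation[D1 der1 D1h] /horner_derivation[D2 der2 D2h] ind.
exists D1, D2; split=> // a b c DE; apply: ind.
have := congr1 (fun D : 'End(A) => D (h 'X)) DE.
rewrite add_lfunE !scale_lfunE D1h D2h derivX !mulr1 => ->.
by rewrite inner_derE one_generator_comm subrr.
Qed.

(** For [m > 2], [x d/dx] and [x^2 d/dx] are independent. For [m = 2] in characteristic 2, [d/dx]
    also descends, since [(X^2)' = 2X = 0], and is paired with [x d/dx]. *)
Lemma one_generator_cases : two_outer_derivations A \/
  [/\ x * x = 0, forall a, exists c d, a = c%:A + d *: x & 2%:R != 0 :> K].
Proof.
have m_gt1 : (1 < m)%N.
  case: m xm => [/eqP|[x0|//]]; first by rewrite expr0 oner_eq0.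
  by case/negP: notJ2x; rewrite -[x]expr1 x0 mem0v.
have lt_m n : (n < m)%N -> x ^+ n != 0.
  by move=> lt_nm; apply/eqP => /min_m; rewrite leqNgt lt_nm.
have hX n : h 'X^n = x ^+ n by rewrite rmorphXn /= horner_algX.
have hder n : h ('X^(n.+1) * ('X^m)^`()) = 0.
  rewrite derivXn mulrnAr -exprD addSn -addnS prednK ?(ltnW m_gt1) //.
  by rewrite rmorphMn /= hX exprD xm mulr0 mul0rn.
have [m2 | m_gt2] := leqP m 2; last first.
  left; apply: (two_outer_of_polys (hder 0%N) (hder 1%N)) => a b;
    rewrite !hX => ab.
  have a0 : a = 0.
    (* This factor kills the [x^2] term but not the [x] term. *)
    have := congr1 ( *%R (x ^+ (m - 2))) ab.
    rewrite mulrDr mulr0 -!scalerAr -!exprD subnK // xm scaler0 addr0.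
    have: x ^+ (m - 2 + 1) != 0.
      by rewrite lt_m // addn1 -subSn // subSS ltn_subrL (ltnW m_gt1).
    by move=> /negPf xn0 /eqP; rewrite scaler_eq0 xn0 orbF => /eqP.
  split=> //; move/eqP: ab; rewrite a0 scale0r add0r scaler_eq0.
  by rewrite (negPf (lt_m 2 _)) ?orbF => [/eqP|].
have Dm : m = 2%N by apply/eqP; rewrite eqn_leq m2.
have xx : x * x = 0 by rewrite -expr2 -Dm.
have x0 : x != 0 by rewrite -[x]expr1 lt_m.
have [two0 | two0] := eqVneq (2%:R : K) 0; [left | right].
  apply: (@two_outer_of_polys 1 'X).
  - by rewrite mul1r Dm derivXn expr1 -mulr_natl -polyC_natr two0 mul0r rmorph0.
  - exact: (hder 0%N).
  rewrite rmorph1 /= horner_algX => a b ab.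
  have a0 : a = 0.
    have := congr1 ( *%R x) ab;
      rewrite mulrDr mulr0 -!scalerAr xx scaler0 addr0.
    by rewrite mulr1 => /eqP; rewrite scaler_eq0 (negPf x0) orbF => /eqP.
  split=> //; move/eqP: ab; rewrite a0 scale0r add0r scaler_eq0.
  by rewrite (negPf x0) orbF => /eqP.
split=> // a; have [p /eqP <-] := one_generator_horner a; exists p`_0, p`_1.
rewrite -[p in LHS](poly_take_drop 2) rmorphD rmorphM /= hX expr2 xx mulr0
  addr0.
rewrite /take_poly poly_def !big_ord_recr big_ord0 /= add0r rmorphD /=.
by rewrite -!mul_polyC !rmorphM !rmorphXn /= horner_algX !horner_algC
  !mulr_algl.
Qed.

End OneGenerator.
End LocalSymmetric.

(** The value [x = 0] records the case [A = k]. Otherwise the number of generators of [J] modulo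
    [J^2] decides which derivations are used. *)
Lemma local_symmetric_cases (K : fieldType) (A : falgType K) (t : {scalar A}) :
    (forall x : A, exists a, nilpotent_elt (x - a%:A)) ->
    (forall x y, t (x * y) = t (y * x)) ->
    (forall x, x != 0 -> exists y, t (x * y) != 0) ->
  two_outer_derivations A \/
  exists x : A, [/\ x * x = 0, forall a, exists c d, a = c%:A + d *: x
    & x = 0 \/ 2%:R != 0 :> K].
Proof.
move=> local_eigen t_sym t_nondeg; have [J memJ] := exists_radical local_eigen.
have [J0 | J0] := eqVneq J 0%VS.
  right; exists 0; split; [by rewrite mul0r | move=> a | by left].
  have [c [j]] := radical_decomp local_eigen memJ a.
  by rewrite J0 memv0 => /eqP-> ->; exists c, 0; rewrite scaler0.
have [x Jx notJ2x] := radical_sq_proper local_eigen memJ J0.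
have [genJ | /subvPn[y Jy notUy]] := boolP (J <= <[x]> + J ^+ 2)%VS; last first.
  by left; apply: (two_generators_outer local_eigen memJ t_sym t_nondeg Jx Jy).
have [n xn] : nilpotent_elt x by apply/memJ.
have ex_n : exists n, x ^+ n == 0 by exists n; apply/eqP.
case: (ex_minnP ex_n) => m /eqP xm min_m.
have min_m' k : x ^+ k = 0 -> (m <= k)%N by move/eqP/min_m.
have [|[xx genA two0]] := one_generator_cases local_eigen memJ Jx notJ2x genJ
  xm min_m'.
  by left.
by right; exists x; split=> //; right.
Qed.

(** * Idempotents and matrix units *)

Section Idempotents.
Variables (K : fieldType) (B : falgType K).
Implicit Types e f g x y : B.

Definition primitive_idem e :=
  [/\ e != 0, e * e = e
    & forall f, f * f = f -> e * f = f -> f * e = f -> f = 0 \/ f = e].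

(** If [gB = fB], then [f = g f = g]. The dimension of [fB] is the measure for splitting
    idempotents. *)
Lemma ltn_dim_idem f g : g * g = g -> f * g = g -> g * f = g -> g != f ->
  (\dim (<[g]> * fullv) < \dim (<[f]> * fullv))%N.
Proof.
move=> gg fg gf; have sgf : (<[g]> * fullv <= <[f]> * fullv)%VS.
  by rewrite -fg -prodv_line -prodvA prodvSr ?subvf.
rewrite ltnNge (geq_leqif (dimv_leqif_sup sgf)); apply: contra => /subvP sfg.
have: f \in (<[g]> * fullv)%VS.
  by rewrite sfg // -[X in X \in _]mulr1 memv_mul ?memv_line ?memvf.
rewrite -[X in X \in _]mul1r.
have Dg x : x \in (<[g]> * fullv)%VS -> g * x = x.
  suff: (<[g]> * fullv <= lker (amull g - \1)%VF)%VS.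
    move=> /subvP sg /sg;
      rewrite memv_ker add_lfunE opp_lfunE id_lfunE lfunE /=.
    by rewrite subr_eq0 => /eqP.
  apply/prodvP => _ y /vlineP[a ->] _.
  rewrite memv_ker add_lfunE opp_lfunE id_lfunE lfunE /= -scalerAl -scalerAr.
  by rewrite mulrA gg subrr.
by rewrite mul1r => /Dg <-; rewrite gf.
Qed.

Lemma exists_primitive_idem f : f != 0 -> f * f = f ->
  exists e, [/\ primitive_idem e, f * e = e & e * f = e].
Proof.
move=> f0 ff; pose Q g := [/\ g != 0, g * g = g, f * g = g & g * f = g].
have [|e [e0 ee fe ef] min_e] := @exists_argmin _ Q (fun g => \dim (<[g]> *
  fullv)).
  by exists f.
exists e; split=> //; split=> // g gg eg ge.
have [-> | g0] := eqVneq g 0; first by left.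
right; apply/eqP; apply/negPn/negP => neq_ge.
have Qg : Q g.
  by split=> //; [rewrite -eg mulrA fe | rewrite -ge -mulrA ef].
by have := ltn_dim_idem gg eg ge neq_ge; rewrite ltnNge (min_e g Qg).
Qed.

Section Corner.
Variable e : B.
Hypotheses (e0 : e != 0) (ee : e * e = e).

Definition corner : {vspace B} := limg (amulr e \o amull e)%VF.

Lemma memv_corner x : (x \in corner) = (e * x * e == x).
Proof.
apply/memv_imgP/eqP => [[y _ ->] | <-].
  by rewrite comp_lfunE !lfunE /= !mulrA ee -mulrA ee.
by exists x; rewrite ?memvf // comp_lfunE !lfunE.
Qed.

Lemma corner_mull x : x \in corner -> e * x = x.
Proof. by rewrite memv_corner => /eqP <-; rewrite !mulrA ee. Qed.

Lemma corner_mulr x : x \in corner -> x * e = x.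
Proof. by rewrite memv_corner => /eqP <-; rewrite -!mulrA ee. Qed.

Lemma corner_is_aspace : is_aspace corner.
Proof.
apply/andP; split.
  apply/has_algidP; exists e; split=> //; first by rewrite memv_corner !ee.
  by move=> x Cx; rewrite corner_mull ?corner_mulr.
apply/prodvP => x y Cx Cy; rewrite memv_corner -!mulrA corner_mulr //.
by rewrite mulrA corner_mull.
Qed.

Definition corner_aspace : {aspace B} := ASpace corner_is_aspace.

Lemma corner_algid : algid corner_aspace = e.
Proof.
rewrite -[LHS](corner_mulr (memv_algid corner_aspace)); apply: algidl.
by rewrite memv_corner !ee.
Qed.

(** For [x] in [eBe], [t (x e y e) = t (x y)]. *)
Lemma corner_trace_nondeg (t : B -> K) :
    (forall x y, t (x * y) = t (y * x)) ->
    (forall x, x != 0 -> exists y, t (x * y) != 0) ->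
  forall x, x \in corner -> x != 0 -> exists2 y, y \in corner & t (x * y) != 0.
Proof.
move=> t_sym t_nondeg x Cx /t_nondeg[y ty]; exists (e * y * e).
  by rewrite memv_corner !mulrA ee -mulrA ee.
by rewrite !mulrA (corner_mulr Cx) t_sym mulrA (corner_mull Cx).
Qed.

End Corner.
End Idempotents.

Lemma primitive_corner_eigen (K : closedFieldType) (B : falgType K) (e : B)
    (e0 : e != 0) (ee : e * e = e) : primitive_idem e ->
  forall x : subvs_of (corner_aspace e0 ee), exists a, nilpotent_elt (x - a%:A).
Proof.
case=> _ _ prim; apply: local_eigenvalue => f ff.
have Cf := subvsP f.
have [||f0|f1] := prim (vsval f) (congr1 vsval ff).
- exact: corner_mull Cf.
- exact: corner_mulr Cf.
- by left; apply: val_inj.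
- by right; apply: val_inj; rewrite /= corner_algid.
Qed.

Lemma primitive_corner_unit (K : closedFieldType) (B : falgType K) (e x : B) :
    primitive_idem e -> x \in corner e ->
  nilpotent_elt x \/ exists2 y, y \in corner e & y * x = e.
Proof.
move=> prim Cx; have [e0 ee _] := prim.
pose C := corner_aspace e0 ee; pose X : subvs_of C := Subvs Cx.
have [UX | [n Xn]] := unit_or_nilpotent (primitive_corner_eigen prim) X.
  right; exists (vsval X^-1); first exact: subvsP.
  by rewrite -[LHS]/(vsval (X^-1 * X)) mulVr //= corner_algid.
(* The zeroth power is [e] in the corner but [1] in [B], so powers are compared from exponent 1
   on. *)
left; exists n.+1; have: vsval (X ^+ n.+1) = 0 by rewrite exprS Xn mulr0.
move=> <-; elim: n {Xn} => [|n IHn]; first by rewrite !expr1.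
by rewrite exprS IHn [in RHS]exprS.
Qed.

(** * Minimal left ideals as simple modules *)

Section LeftIdealModule.
Variables (K : fieldType) (B : falgType K) (L : {vspace B}).

(** Stability of [L] is an argument of the type, so that the [B]-module structure can be attached to
    it. *)
Definition left_ideal_mod of (fullv * L <= L)%VS := subvs_of L.

Hypothesis idL : (fullv * L <= L)%VS.

HB.instance Definition _ := GRing.Zmodule.on (left_ideal_mod idL).

Fact left_ideal_scale_subproof (x : B) (l : subvs_of L) : x * vsval l \in L.
Proof. by rewrite (subvP idL) // memv_mul ?memvf ?subvsP. Qed.

Definition left_ideal_scale (x : B) (l : left_ideal_mod idL) :
  left_ideal_mod idL := Subvs (left_ideal_scale_subproof x l).

Fact left_ideal_scaleA x y l :
  left_ideal_scale x (left_ideal_scale y l) = left_ideal_scale (x * y) l.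
Proof. by apply: val_inj; rewrite /= mulrA. Qed.
Fact left_ideal_scale1 : left_id 1 left_ideal_scale.
Proof. by move=> l; apply: val_inj; rewrite /= mul1r. Qed.
Fact left_ideal_scaleDr : right_distributive left_ideal_scale +%R.
Proof. by move=> x l l'; apply: val_inj; rewrite /= mulrDr. Qed.
Fact left_ideal_scaleDl l : {morph left_ideal_scale^~ l : x y / x + y}.
Proof. by move=> x y; apply: val_inj; rewrite /= mulrDl. Qed.

HB.instance Definition _ :=
  GRing.Zmodule_isLmodule.Build B (left_ideal_mod idL) left_ideal_scaleA
    left_ideal_scale1 left_ideal_scaleDr left_ideal_scaleDl.

Lemma left_ideal_modE x (l : left_ideal_mod idL) :
  vsval (x *: l : left_ideal_mod idL) = x * vsval l.
Proof. by []. Qed.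

End LeftIdealModule.

Section MinimalLeftIdeals.
Variables (K : closedFieldType) (B : falgType K).
Implicit Types (L W : {vspace B}) (e x y l : B).

Definition minimal_left_ideal L := [/\ L != 0%VS, (fullv * L <= L)%VS
  & forall l x, l \in L -> l != 0 -> x \in L -> exists y, x = y * l].

Lemma exists_minimal_left_ideal W : W != 0%VS -> (fullv * W <= W)%VS ->
  exists2 L, minimal_left_ideal L & (L <= W)%VS.
Proof.
move=> W0 idW.
pose Q L := [/\ L != 0%VS, (fullv * L <= L)%VS & (L <= W)%VS].
have [|L [L0 idL sLW] minL] := @exists_argmin _ Q (fun L => \dim L).
  by exists W.
exists L => //; split=> // l x Ll l0 Lx.
have Bl : l \in (fullv * <[l]>)%VS.
  by rewrite -[X in X \in _]mul1r memv_mul ?memvf ?memv_line.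
have sBL : (fullv * <[l]> <= L)%VS.
  by rewrite (subv_trans _ idL) // prodvSr -?memvE.
have /minL: Q (fullv * <[l]>)%VS.
  split; last exact: subv_trans sBL sLW.
    by apply: contraNneq l0 => Bl0; rewrite Bl0 memv0 in Bl.
  by rewrite prodvA prodvSl ?subvf.
rewrite (geq_leqif (dimv_leqif_sup sBL)) => /subvP/(_ x Lx).
by rewrite -limg_amulr => /memv_imgP[y _]; rewrite lfunE; exists y.
Qed.

Lemma minimal_left_ideal_simple L (idL : (fullv * L <= L)%VS) :
  minimal_left_ideal L -> simple_module (left_ideal_mod idL).
Proof.
case=> L0 _ minL; split.
  have Lv := memv_pick L; exists (Subvs Lv : left_ideal_mod idL).
  by apply: contraNneq L0 => /(congr1 vsval) /= v0; rewrite -vpick0 v0.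
move=> S [S0 SL]; have SZ x s : s \in S -> x *: s \in S.
  by move=> Ss; rewrite -[_ *: _]addr0 SL.
have [[s Ss s0] | S_le0] := classic (exists2 s, s \in S & s != 0); last first.
  left=> s; rewrite inE; apply/idP/eqP => [Ss | -> //].
  by apply/eqP/negPn/negP => s0; case: S_le0; exists s.
right=> l; rewrite [RHS]inE.
have [|y Dl] := minL (vsval s) (vsval l) (subvsP s) _ (subvsP l).
  by apply: contraNneq s0 => s0; apply/eqP/val_inj.
suff -> : l = y *: s by apply: SZ.
exact: val_inj.
Qed.

(** Annihilation by [e] is invariant under isomorphism, and both ideals are isomorphic to the unique
    simple module. *)
Lemma iso_minimal_left_ideals L L' e : unique_simple_module B ->
    minimal_left_ideal L -> minimal_left_ideal L' ->
  (exists2 l, l \in L & e * l != 0) -> exists2 l, l \in L' & e * l != 0.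
Proof.
move=> [V [_ isoV]] mL mL' [l Ll el].
have [[_ idL _] [_ idL' _]] := (mL, mL').
have [f [f' fK f'K]] := isoV _ (minimal_left_ideal_simple idL mL).
have [g [g' gK _]] := isoV _ (minimal_left_ideal_simple idL' mL').
pose s : left_ideal_mod idL := Subvs Ll; pose v := f' s.
have ev : e *: v != 0.
  apply: contraNneq el => ev; have := linearZ_LR f e v.
  rewrite ev linear0 f'K => /esym/(congr1 vsval);
    rewrite left_ideal_modE /= => ->.
  by rewrite eqxx.
exists (vsval (g v)); first exact: subvsP.
apply: contraNneq ev => egv; apply/eqP/(can_inj gK).
by rewrite linear0 linearZ_LR; apply: val_inj.
Qed.

End MinimalLeftIdeals.

(** * Matrix units in a symmetric algebra with one simple module *)

Section MatrixUnits.
Variables (K : closedFieldType) (B : falgType K) (t : {scalar B}).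
Hypothesis t_sym : forall x y, t (x * y) = t (y * x).
Hypothesis t_nondeg : forall x, x != 0 -> exists y, t (x * y) != 0.
Hypothesis one_simple : unique_simple_module B.
Implicit Types e f x y : B.

(** For [w] in [L], [w = w e], so [t w = t (e w)]. If [e] annihilated [L], [t] would vanish on this
    left ideal, against nondegeneracy. *)
Lemma trace_minimal_left_ideal e L : e != 0 -> e * e = e ->
    minimal_left_ideal L -> (L <= fullv * <[e]>)%VS ->
  exists2 l, l \in L & e * l != 0.
Proof.
move=> e0 ee [L0 /subvP idL _] sLe; pose l := vpick L.
have Ll : l \in L := memv_pick L.
have [|y ty] := @t_nondeg l; first by rewrite vpick0.
have Lyl : y * l \in L by rewrite idL // memv_mul ?memvf.
exists (y * l) => //; apply: contraNneq ty => eyl.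
have: y * l \in (fullv * <[e]>)%VS by apply: subvP Lyl.
rewrite -limg_amulr => /memv_imgP[z _]; rewrite lfunE /= => Dz.
by rewrite t_sym Dz -ee mulrA -Dz t_sym eyl linear0.
Qed.

(** Neither [e] nor [f] annihilates the minimal left ideal [L] of [Be]. Transitivity on [L] gives
    [y], [y'] such that [e y f y' e] fixes a nonzero vector; it is then not nilpotent, hence
    invertible in the local algebra [eBe]. *)
Lemma primitive_idems_equiv e f : primitive_idem e -> primitive_idem f ->
  exists u v, [/\ e * u = u, u * f = u, f * v = v, v * e = v & u * v = e /\ v *
    u = f].
Proof.
move=> pe pf; have [[e0 ee _] [f0 ff prim_f]] := (pe, pf).
have minL (g : B) : primitive_idem g ->
    exists2 L, minimal_left_ideal L & (L <= fullv * <[g]>)%VS.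
  case=> g0 gg _; apply: exists_minimal_left_ideal.
    apply: contraNneq g0 => Bg0; rewrite -memv0 -Bg0 -[X in X \in _]mul1r.
    by rewrite memv_mul ?memvf ?memv_line.
  by rewrite prodvA prodvSl ?subvf.
have [[L mL sLe] [M mM sMf]] := (minL e pe, minL f pf).
have [l0 Ll0 el0] := trace_minimal_left_ideal e0 ee mL sLe.
have [l Ll fl] := iso_minimal_left_ideals one_simple mM mL
  (trace_minimal_left_ideal f0 ff mM sMf).
have [_ /subvP idL trL] := mL; have LB x y : y \in L -> x * y \in L.
  by move=> Ly; rewrite idL // memv_mul ?memvf.
have [y Dl0] := trL (f * l) l0 (LB f l Ll) fl Ll0.
have l1nz : e * y * f * l != 0 by rewrite -!mulrA -[y * _]Dl0.
have [y' Dl] := trL (e * y * f * l) l (LB _ _ Ll) l1nz Ll.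
set l1 := e * y * f * l in l1nz Dl.
have el1 : e * l1 = l1 by rewrite /l1 !mulrA ee.
have Cw : e * y * f * y' * e \in corner e.
  by rewrite memv_corner // !mulrA ee -mulrA ee.
have [[n wn]|[c Cc cw]] := primitive_corner_unit pe Cw.
  have wl1 : e * y * f * y' * e * l1 = l1 by rewrite -[_ * e * l1]mulrA el1
    -mulrA -Dl.
  suff wnl k : (e * y * f * y' * e) ^+ k * l1 = l1.
    by case/eqP: l1nz; rewrite -(wnl n) wn mul0r.
  by elim: k => [|k IHk]; [rewrite mul1r | rewrite exprSr -mulrA wl1].
have ec := corner_mull ee Cc.
pose u := c * (e * y * f); pose v := f * y' * e; exists u, v.
have uv : u * v = e by rewrite -cw /u /v -!mulrA [f * (f * _)]mulrA ff.
have vnz : v * u != 0.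
  apply: contraNneq e0 => vu;
    rewrite -ee -{1}uv -uv -mulrA [v * (u * v)]mulrA vu.
  by rewrite mul0r mulr0.
have fv : f * v = v by rewrite /v !mulrA ff.
have uf : u * f = u by rewrite /u -!mulrA ff.
have ve : v * e = v by rewrite /v -!mulrA ee.
split=> //; first by rewrite /u !mulrA ec.
(* [v u] is a nonzero idempotent of [fBf], so primitivity makes it [f]. *)
split=> //; have [|||vu0|//] := prim_f (v * u).
- by rewrite mulrA -[v * u * v]mulrA uv ve.
- by rewrite mulrA fv.
- by rewrite -mulrA uf.
by rewrite vu0 eqxx in vnz.
Qed.

(** Primitive idempotents, each equivalent to [e], are split off [f] by induction on the dimension
    of [fB]; the products [v i * u i] are these pieces. *)
Lemma exists_matrix_units e f : primitive_idem e -> f * f = f ->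
  exists m (u v : 'I_m -> B),
    [/\ forall i, e * u i = u i /\ u i * f = u i,
        forall i, v i * e = v i /\ f * v i = v i,
        forall i j, u i * v j = if i == j then e else 0
      & \sum_i v i * u i = f].
Proof.
move=> pe; have [n] := ubnP (\dim (<[f]> * fullv));
  elim: n f => // n IHn f lt_n ff.
have [-> | f0] := eqVneq f 0.
  by exists 0%N, (fun=> 0), (fun=> 0); split=> [[]|[]|[]|] //; rewrite big_ord0.
have [g [pg fg gf]] := exists_primitive_idem f0 ff.
have [g0 gg _] := pg; pose h := f - g.
have hh : h * h = h by rewrite /h mulrBl !mulrBr ff gg fg gf subrr subr0.
have fh : f * h = h by rewrite /h mulrBr ff fg.
have hf : h * f = h by rewrite /h mulrBl ff gf.
have gh : g * h = 0 by rewrite /h mulrBr gf gg subrr.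
have hg : h * g = 0 by rewrite /h mulrBl fg gg subrr.
have neq_hf : h != f by rewrite -subr_eq0 /h addrAC subrr sub0r oppr_eq0.
have lt_h : (\dim (<[h]> * fullv) < n)%N.
  exact: leq_trans (ltn_dim_idem hh fh hf neq_hf) _.
have [m [u [v [eu ve uv sum_vu]]]] := IHn h lt_h hh.
have [u0 [v0 [eu0 u0g gv0 v0e [uv0 vu0]]]] := primitive_idems_equiv pe pg.
(* The index [ord0] belongs to the new piece [g], the others to [h = f - g]. *)
pose U i := if unlift ord0 i is Some j then u j else u0.
pose V i := if unlift ord0 i is Some j then v j else v0.
exists m.+1, U, V; split.
- move=> i; rewrite /U; case: unliftP => [j _ | _].
    by have [eu_j uh] := eu j; split=> //; rewrite -{1}uh -mulrA hf.
  by split=> //; rewrite -u0g -mulrA gf.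
- move=> i; rewrite /V; case: unliftP => [j _ | _].
    by have [ve_j hv] := ve j; split=> //; rewrite -{1}hv mulrA fh.
  by split=> //; rewrite -gv0 mulrA fg.
- move=> i j; rewrite /U /V; case: unliftP => [i1|] ->;
  case: unliftP => [j1|] ->.
  + by rewrite (inj_eq lift_inj) uv.
  + rewrite -gv0 -(eu i1).2 -mulrA [h * _]mulrA hg mul0r mulr0.
    by rewrite eq_sym (negPf (neq_lift _ _)).
  + rewrite -u0g -(ve j1).2 -mulrA [g * _]mulrA gh mul0r mulr0.
    by rewrite (negPf (neq_lift _ _)).
  by rewrite eqxx.
rewrite big_ord_recl /U /V unlift_none vu0.
by under eq_bigr do rewrite liftK; rewrite sum_vu addrC subrK.
Qed.

End MatrixUnits.

(** * Extension of derivations from a corner to a matrix algebra *)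

Section LiftDerivation.
Variables (K : fieldType) (B : falgType K) (e : B).
Hypotheses (e0 : e != 0) (ee : e * e = e).
Variables (m : nat) (u v : 'I_m -> B).
Hypotheses (eu : forall i, e * u i = u i) (ve : forall i, v i * e = v i).
Hypothesis uv : forall i j, u i * v j = if i == j then e else 0.
Hypothesis sum_vu : \sum_i v i * u i = 1.
Local Notation A := (subvs_of (corner_aspace e0 ee)).
Implicit Types (y z : B) (f g : 'I_m -> 'I_m -> A).

Fact coord_subproof i j y : u i * y * v j \in corner e.
Proof. by rewrite memv_corner // !mulrA eu -mulrA ve. Qed.

(** The Peirce coordinates, which identify [B] with the [m] by [m] matrices over [A]; [of_mx] is the
    inverse map. *)
Definition mx_coord y i j : A := Subvs (coord_subproof i j y).

Definition of_mx f : B := \sum_i \sum_j v i * vsval (f i j) * u j.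

Lemma of_mxK f i j : mx_coord (of_mx f) i j = f i j.
Proof.
have [Cl Cr] := (corner_mull ee (subvsP (f i j)), corner_mulr ee (subvsP (f i
  j))).
apply: val_inj; rewrite /= mulr_sumr mulr_suml (bigD1 i) //= [X in _ + X]big1
  ?addr0; last first.
  move=> k ki; rewrite mulr_sumr mulr_suml big1 // => l _.
  by rewrite !mulrA uv eq_sym (negPf ki) !mul0r.
rewrite mulr_sumr mulr_suml (bigD1 j) //= [X in _ + X]big1 ?addr0; last first.
  by move=> k kj; rewrite -!mulrA uv (negPf kj) !mulr0.
by rewrite !mulrA uv eqxx -mulrA uv eqxx Cl Cr.
Qed.

Lemma mx_coordK y : of_mx (mx_coord y) = y.
Proof.
rewrite -[RHS]mulr1 -[in RHS](mul1r y) -sum_vu !mulr_suml;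
  apply: eq_bigr => i _.
by rewrite mulr_sumr; apply: eq_bigr => j _; rewrite !mulrA.
Qed.

Lemma mx_coordM y z i j :
  mx_coord (y * z) i j = \sum_k mx_coord y i k * mx_coord z k j.
Proof.
apply: val_inj; rewrite /= raddf_sum /=.
rewrite -{1}[y]mulr1 -sum_vu mulr_sumr mulr_suml mulr_sumr mulr_suml.
by apply: eq_bigr => k _; rewrite !mulrA.
Qed.

Lemma mx_coord_linear i j : linear (fun y => mx_coord y i j).
Proof.
move=> a y z; apply: val_inj; rewrite /= mulrDr mulrDl.
by rewrite -scalerAr -scalerAl.
Qed.

Lemma of_mx_linear a f g :
  of_mx (fun i j => a *: f i j + g i j) = a *: of_mx f + of_mx g.
Proof.
rewrite /of_mx scaler_sumr -big_split; apply: eq_bigr => i _.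
rewrite scaler_sumr -big_split; apply: eq_bigr => j _ /=.
by rewrite mulrDr mulrDl -scalerAr -scalerAl.
Qed.

Lemma eq_of_mx f g : (forall i j, f i j = g i j) -> of_mx f = of_mx g.
Proof. by move=> fg; apply: eq_bigr => i _; apply: eq_bigr => j _;
  rewrite fg. Qed.

Lemma of_mxM f g : of_mx f * of_mx g = of_mx (fun i j => \sum_k f i k * g k j).
Proof.
rewrite -[LHS]mx_coordK; apply: eq_of_mx => i j; rewrite mx_coordM.
by apply: eq_bigr => k _; rewrite !of_mxK.
Qed.

Lemma lift_derivation (d : 'End(A)) : derivation d ->
  exists2 D : 'End(B), derivation D
    & forall y, D y = of_mx (fun i j => d (mx_coord y i j)).
Proof.
move=> der_d; have [|D DE] := @lfun_of_linear K B B
  (fun y => of_mx (fun i j => d (mx_coord y i j))).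
  move=> a y z; rewrite -of_mx_linear; apply: eq_of_mx => i j.
  by rewrite mx_coord_linear linearP.
exists D => // y z; rewrite !DE -[X in _ = _ * X + _]mx_coordK -[X in _ = _ + X
  * _]mx_coordK !of_mxM.
rewrite -[X in _ = X + _]scale1r -of_mx_linear; apply: eq_of_mx => i j.
rewrite scale1r mx_coordM linear_sum -big_split; apply: eq_bigr => k _ /=.
exact: der_d.
Qed.

(** On [w] placed in the diagonal position [i0], an inner derivation by [c] has as its [i0] diagonal
    entry the inner derivation of [w] by the [i0] diagonal entry of [c]. *)
Lemma lift_two_outer : two_outer_derivations A -> two_outer_derivations B.
Proof.
move=> [d1 [d2 [/lift_derivation[D1 der1 D1E] /lift_derivation[D2 der2 D2E]
  ind]]].
exists D1, D2; split=> // a b c DE.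
have [i0] : exists i0 : 'I_m, True.
  case: m u v sum_vu => [u' v'|n _ _ _]; last by exists ord0.
  by rewrite big_ord0 => /esym/eqP; rewrite oner_eq0.
move=> _; apply: (ind a b (mx_coord c i0 i0)); apply/lfunP => w.
pose y := v i0 * vsval w * u i0.
have [Cl Cr] := (corner_mull ee (subvsP w), corner_mulr ee (subvsP w)).
have yw : mx_coord y i0 i0 = w.
  by apply: val_inj; rewrite /= /y !mulrA uv eqxx -mulrA uv eqxx Cl Cr.
have /= := congr1 (fun D : 'End(B) => mx_coord (D y) i0 i0) DE.
rewrite !inner_derE !add_lfunE !scale_lfunE mx_coord_linear -[b *: D2 y]addr0.
rewrite mx_coord_linear D1E D2E !of_mxK yw.
have -> : mx_coord 0 i0 i0 = 0 by apply: val_inj; rewrite /= mulr0 mul0r.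
rewrite addr0 => ->; apply: val_inj.
rewrite /= mulrBr mulrBl /y !mulrA -[_ * u i0 * v i0]mulrA !uv eqxx Cl.
by rewrite -!mulrA Cr.
Qed.

End LiftDerivation.

Lemma leq_dim_HH1 (K : fieldType) (B : falgType K) :
  two_outer_derivations B -> (2 <= \dim {: HH1 B})%N.
Proof.
move=> [D1 [D2 [der1 der2 ind]]]; rewrite dim_HH1.
have notI a b : (a != 0) || (b != 0) -> a *: D1 + b *: D2 \notin IDer B.
  move=> ab; apply/negP => /memv_IDer[c /ind[a0 b0]].
  by rewrite a0 b0 eqxx in ab.
have dim1 : (\dim (IDer B) < \dim (IDer B + <[D1]>))%N.
  rewrite ltnNge (geq_leqif (dimv_leqif_sup (addvSl _ _))) subv_add subvv /=.
  by rewrite -memvE -[D1]addr0 -(scale0r D2) -[D1]scale1r notI ?oner_eq0.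
have dim2 : (\dim (IDer B + <[D1]>) < \dim (IDer B + <[D1]> + <[D2]>))%N.
  rewrite ltnNge (geq_leqif (dimv_leqif_sup (addvSl _ _))) subv_add subvv /=.
  rewrite -memvE; apply/negP => /memv_addP[f If [_ /vlineP[a ->] D2E]].
  have /negP[] := notI (- a) 1 (introT orP (or_intror (oner_neq0 K))).
  by rewrite scale1r D2E scaleNr addrCA addNr addr0.
have sD : (IDer B + <[D1]> + <[D2]> <= Der B)%VS.
  by rewrite !subv_add IDer_sub_Der -!memvE; apply/andP; split; apply/memv_Der.
rewrite leq_subRL ?dimvS ?IDer_sub_Der // addn2.
by rewrite (leq_trans _ (dimvS sD)) // (leq_trans _ dim2).
Qed.

Section OneSimple.
Variables (K : closedFieldType) (B : falgType K) (t : {scalar B}).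
Hypothesis t_sym : forall x y, t (x * y) = t (y * x).
Hypothesis t_nondeg : forall x, x != 0 -> exists y, t (x * y) != 0.

(** The second alternative describes a matrix algebra over the span of [e] and [x], with [x = 0]
    when the corner is [k]. *)
Lemma one_simple_cases : unique_simple_module B ->
  two_outer_derivations B \/
  exists m (e x : B) (u v : 'I_m -> B), [/\ e != 0 /\ e * e = e,
    [/\ forall i, e * u i = u i, forall i, v i * e = v i,
        forall i j, u i * v j = if i == j then e else 0 & \sum_i v i * u i = 1],
    e * x = x /\ x * e = x, x * x = 0 /\ (x = 0 \/ 2%:R != 0 :> K)
    & forall y, exists c d, e * y * e = c *: e + d *: x].
Proof.
move=> one_simple; have [e [pe _ _]] := exists_primitive_idem (oner_neq0 B)
  (mulr1 1).
have [m [u [v [eu ve uv sum_vu]]]] := exists_matrix_units t_sym t_nondeg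
  one_simple pe (mulr1 1).
have [e0 ee _] := pe; pose C := corner_aspace e0 ee.
pose s : {scalar subvs_of C} := t \o vsval.
have [x y|x x0|outer|[x [xx genx x0]]] := @local_symmetric_cases _ _ s
  (primitive_corner_eigen pe).
- exact: t_sym.
- have [//|y Cy ty] := corner_trace_nondeg ee t_sym t_nondeg (subvsP x).
  by exists (Subvs Cy : subvs_of C).
- left; exact: lift_two_outer (fun i => (eu i).1) (fun i => (ve i).1) uv sum_vu
  outer.
right; exists m, e, (vsval x), u, v; split=> //.
- by split=> // i; [case: (eu i)|case: (ve i)].
- by rewrite (corner_mull ee (subvsP x)) (corner_mulr ee (subvsP x)).
- split; first exact: (congr1 vsval xx).
  by case: x0 => [->|]; [left; rewrite linear0 | right].
move=> y; have Cy : e * y * e \in corner e by rewrite memv_corner // !mulrA ee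
  -mulrA ee.
have [c [d /(congr1 vsval) /=]] := genx (Subvs Cy : subvs_of C).
by rewrite (corner_algid e0 ee) => Dy; exists c, d.
Qed.

End OneSimple.

(** * Group algebras and blocks *)

(** [s] generates a cyclic [p]-group and [F] is constant on its orbits. Orbits of size divisible by
    [p] contribute zero, and fixed points do so by assumption. *)
Lemma sum_iter_invariant (p : nat) (K : fieldType) (T : finType) (s : T -> T) n
    (F : T -> K) :
    p \in [pchar K] -> (forall x, iter (p ^ n) s x = x) ->
    (forall x, F (s x) = F x) -> (forall x, s x = x -> F x = 0) ->
  \sum_x F x = 0.
Proof.
move=> pK sK Fs Fix0; have pr_p := pcharf_prime pK.
have inj_s : injective s.
  move=> x y sxy; rewrite -[x]sK -[y]sK -(prednK (_ : 0 < p ^ n)%N) ?expn_gt0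
    ?prime_gt0 //.
  by rewrite !iterSr sxy.
pose S := perm inj_s; have SE x : S x = s x by rewrite permE.
have oS : (#[S]%g %| p ^ n)%N.
  rewrite order_dvdn; apply/eqP/permP => x; rewrite permX perm1 -[RHS]sK.
  by apply: eq_iter.
rewrite (partition_big (porbit S) predT) //= big1 // => O _.
have [x Ox | noO] := pickP (fun x => porbit S x == O); last first.
  by rewrite big_pred0.
transitivity (\sum_(y in porbit S x) F x).
  apply: eq_big => y; rewrite -(eqP Ox) eq_porbit_mem // => /porbitP[i ->].
  by rewrite permX; elim: i => [|i IHi] //; rewrite iterS SE Fs.
rewrite sumr_const.
have: (#|porbit S x| %| p ^ n)%N.
  by rewrite porbit.unlock (dvdn_trans (dvdn_orbit 'P%act <[S]>%G x) oS).
case/(dvdn_pfactor _ _ pr_p) => [[|i] _ oi].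
  have /cards1P[y Dy] : #|porbit S x| == 1%N by rewrite oi.
  have [/set1P xy /set1P sxy] : x \in [set y] /\ S x \in [set y].
    by rewrite -Dy porbit_id -[S]expg1 mem_porbit.
  by rewrite Fix0 ?mul0rn // -SE sxy xy.
by rewrite oi expnS mulrnA (mulrn_pchar pK) mul0rn.
Qed.

(** * The symmetrizing form of the group algebra *)

Section GroupAlgebraElements.
Variables (k : fieldType) (gT : finGroupType).
Implicit Types (x y z w : galg k gT) (g h : gT).

Fact galg_unit_coef_is_linear : linear (fun x : galg k gT => x 1%g : k^o).
Proof. by move=> a x y; rewrite !ffunE. Qed.
Definition unit_coef x : k := x 1%g.
HB.instance Definition _ := GRing.isSemilinear.Build k (galg k gT) k _ unit_coef
  (GRing.semilinear_linear galg_unit_coef_is_linear).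

Lemma galg_mulE x y g : (x * y) g = \sum_h x h * y (h^-1 * g)%g.
Proof. by rewrite ffunE. Qed.

Lemma unit_coef_sym x y : unit_coef (x * y) = unit_coef (y * x).
Proof.
rewrite /unit_coef !galg_mulE (reindex_inj invg_inj) /=; apply: eq_bigr => h _.
by rewrite !mulg1 invgK mulrC.
Qed.

Lemma mul_galg_of x g h : (x * galg_of k g) h = x (h * g^-1)%g.
Proof.
rewrite galg_mulE (bigD1 (h * g^-1)%g) //= big1 => [|l neq].
  by rewrite ffunE invMg invgK mulgKV eqxx mulr1 addr0.
rewrite ffunE; case: eqP => [Dg|]; last by rewrite mulr0.
by case/eqP: neq; rewrite -Dg invMg invgK mulKVg.
Qed.

Lemma galg_of_mul x g h : (galg_of k g * x) h = x (g^-1 * h)%g.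
Proof.
rewrite galg_mulE (bigD1 g) //= big1 => [|l /negPf neq].
  by rewrite ffunE eqxx mul1r addr0.
by rewrite ffunE neq mul0r.
Qed.

Lemma unit_coef_galg_of x g : unit_coef (x * galg_of k g^-1) = x g.
Proof. by rewrite /unit_coef mul_galg_of invgK mul1g. Qed.

Lemma unit_coef_nondeg x : x != 0 -> exists g, unit_coef (x * galg_of k g) != 0.
Proof.
move=> x0; have [g xg | x_0] := pickP (fun g => x g != 0).
  by exists g^-1%g; rewrite unit_coef_galg_of.
by case/eqP: x0; apply/ffunP => g; rewrite ffunE; apply/eqP/negbFE.
Qed.

Lemma galg_sum x : x = \sum_g x g *: galg_of k g.
Proof.
apply/ffunP => h; rewrite sum_ffunE (bigD1 h) //= big1 => [|g neq].
  by rewrite !ffunE eqxx addr0; apply/esym/mulr1.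
by rewrite !ffunE eq_sym (negPf neq); apply: mulr0.
Qed.

(** The bases [g] and [g^-1] are dual for the form [unit_coef]. *)
Lemma galg_dual_sum w : \sum_g unit_coef (galg_of k g^-1 * w) *: galg_of k g =
  w.
Proof.
by rewrite [RHS]galg_sum; apply: eq_bigr => g _;
  rewrite unit_coef_sym unit_coef_galg_of.
Qed.

Lemma galg_ofX g n : galg_of k (g ^+ n)%g = galg_of k g ^+ n.
Proof. by elim: n => [|n IHn] //; rewrite expgS exprS galg_ofM IHn. Qed.

Lemma galg_exp y q h : (y ^+ q) h =
  \sum_(f : {ffun 'I_q -> gT}) (\prod_i y (f i)) * ((\prod_i f i)%g == h)%:R.
Proof.
have ->: y ^+ q = \prod_(i < q) \sum_g y g *: galg_of k g.
  by rewrite -galg_sum prodr_const card_ord.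
rewrite bigA_distr_bigA sum_ffunE; apply: eq_bigr => f _ /=.
rewrite scaler_prod -(big_morph (@galg_of k gT) (@galg_ofM k gT) erefl) !ffunE.
by rewrite eq_sym.
Qed.

End GroupAlgebraElements.

(** * Rotation of tuples and coefficients at [p]-elements *)

Section TwistedRotation.
Variables (gT : finGroupType) (q : nat) (u : gT).
Implicit Types f : {ffun 'I_q.+1 -> gT}.

(* (g_0, ..., g_q) |-> (g_1, ..., g_q, g_0 ^ u): it preserves the condition
   g_0 ... g_q = u, and its (q + 1)-st iterate is conjugation by u. *)
Definition twisted_rot f : {ffun 'I_q.+1 -> gT} :=
  [ffun i : 'I_q.+1 => if (i < q)%N then f (inord i.+1) else (f ord0 ^ u)%g].

Lemma iter_twisted_rot n f i : (n <= q.+1)%N ->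
  iter n twisted_rot f i =
  (if (i + n < q.+1)%N then f (inord (i + n)) else f (inord (i + n - q.+1)) ^
    u)%g.
Proof.
elim: n i => [|n IHn] i lt_n; first by rewrite /= addn0 ltn_ord inord_val.
rewrite iterS ffunE; have [lt_iq | le_qi] := ltnP i q.
  by rewrite (IHn _ (ltnW lt_n)) inordK ?ltnS // addSnnS.
have Di : i = q :> nat by apply/eqP; rewrite eqn_leq le_qi -ltnS ltn_ord.
rewrite (IHn _ (ltnW lt_n)) add0n lt_n Di addnS ltnS ltnNge leq_addr /=.
by rewrite subSS addKn.
Qed.

Lemma iter_twisted_rot_full f :
  iter q.+1 twisted_rot f = [ffun i => (f i ^ u)%g].
Proof.
apply/ffunP => i; rewrite iter_twisted_rot // ffunE ltnNge leq_addl /=.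
by rewrite addnK inord_val.
Qed.

Lemma iter_twisted_rot_order n f :
  iter (n * q.+1) twisted_rot f = [ffun i => (f i ^ (u ^+ n))%g].
Proof.
elim: n => [|n IHn]; first by apply/ffunP => i; rewrite ffunE expg0 conjg1.
rewrite mulSn iterD IHn iter_twisted_rot_full; apply/ffunP => i.
by rewrite !ffunE -conjgM -expgSr.
Qed.

Lemma lift0_inord (i : 'I_q) : lift ord0 i = inord i.+1.
Proof. by apply: val_inj; rewrite /= inordK ?ltnS. Qed.

(** With [P = g_1 ... g_q], both equations say that [P u^-1] and [g_0] are mutually inverse. *)
Lemma twisted_rot_prod f :
  ((\prod_i twisted_rot f i)%g == u) = ((\prod_i f i)%g == u).
Proof.
rewrite big_ord_recr [in RHS]big_ord_recl ffunE ltnn.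
rewrite (eq_bigr (fun i => f (lift ord0 i))) => [|i _]; last first.
  by rewrite ffunE /= ltn_ord lift0_inord.
set P := (\prod_(i < q) _)%g; rewrite conjgE /= !mulgA.
apply/idP/idP => /eqP fu; apply/eqP.
  transitivity (f ord0 * (P * u^-1 * f ord0 * u) * u^-1 * (f ord0)^-1 * u)%g.
    by rewrite !mulgA mulgK mulgK mulgKV.
  by rewrite fu mulgK mulgV mul1g.
by rewrite -fu invMg !mulgA mulgV mul1g mulVg mul1g.
Qed.

Lemma twisted_rot_fix f : twisted_rot f = f ->
  (f ord0 ^ u)%g = f ord0 /\ forall i, f i = f ord0.
Proof.
move=> /ffunP ff; have fE n : (n < q.+1)%N -> f (inord n) = f ord0.
  elim: n => [_|n IHn lt_n]; first by congr (f _); apply: val_inj;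
    rewrite /= inordK.
  by rewrite -(IHn (ltnW lt_n)) -[in RHS]ff ffunE inordK ?(ltnW lt_n) // (lt_n
    : (n < q)%N).
have f_i i : f i = f ord0 by rewrite -[i]inord_val fE.
by split=> //; rewrite -[RHS](f_i ord_max) -[in RHS]ff ffunE ltnn.
Qed.

End TwistedRotation.

(** The coefficient of [y^(p^n)] at [u] sums over [p^n]-tuples with product [u]. A tuple fixed by
    the twisted rotation is constant, so it would give a [p^n]-th root of [u]; all other orbits
    cancel modulo [p]. *)
Lemma coef_p_element_eq0 (p : nat) (k : fieldType) (gT : finGroupType)
    (y : galg k gT) (u : gT) n :
    p \in [pchar k] -> (p.-elt u)%g -> y ^+ (p ^ n) = y ->
    (forall g, y (g ^ u)%g = y g) -> (forall g, (g ^+ (p ^ n))%g != u) ->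
  y u = 0.
Proof.
move=> pk pu yq yu no_root; have pr_p := pcharf_prime pk.
rewrite -yq galg_exp -(prednK (_ : 0 < p ^ n)%N) ?expn_gt0 ?prime_gt0 //.
set q := (p ^ n).-1; have Dq : q.+1 = (p ^ n)%N by rewrite prednK ?expn_gt0
  ?prime_gt0.
have [a ou] := p_natP pu.
(* The [p^n]-th iterate is conjugation by [u], of order dividing [p^a]; hence the exponent
   [a + n]. *)
apply: (@sum_iter_invariant p _ _ (twisted_rot u) (a + n)) => // f.
- rewrite expnD -Dq -ou iter_twisted_rot_order expg_order.
  by apply/ffunP => i; rewrite ffunE conjg1.
- rewrite twisted_rot_prod; congr (_ * _);
  rewrite big_ord_recr [in RHS]big_ord_recl.
  rewrite /= mulrC ffunE ltnn yu; congr (_ * _); apply: eq_bigr => i _.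
  by rewrite ffunE /= ltn_ord lift0_inord.
case/twisted_rot_fix=> _ fE; rewrite (eq_bigr (fun=> f ord0) (fun i _ => fE i)).
have := no_root (f ord0); rewrite -Dq => /negPf no_root_f0.
by rewrite prodg_const card_ord no_root_f0 mulr0.
Qed.

(** Let [p^a] and [r] be the [p]-part and [p']-part of the group order. By Euler, [p^n = 1] modulo
    [r], which fixes [p]-regular elements. Also [n >= a], so every [p^n]-th power has order dividing
    [r]. *)
Lemma exists_p_regular_power (p : nat) (gT : finGroupType) : prime p ->
  exists n, [/\ (0 < n)%N,
    forall g : gT, (p^'.-elt g)%g -> (g ^+ (p ^ n))%g = g
    & forall g u : gT, (p.-elt u)%g -> u != 1%g -> (g ^+ (p ^ n))%g != u].
Proof.
move=> pr_p; pose r := (#|gT|`_p^')%N; pose a := logn p #|gT|.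
have r_gt0 : (0 < r)%N by apply: part_gt0.
have gT_gt0 : (0 < #|gT|)%N by apply/card_gt0P; exists 1%g.
have co_pr : coprime p r by rewrite (@pnat_coprime p) ?pnat_id ?part_pnat.
have tr_gt0 : (0 < totient r)%N by rewrite totient_gt0.
have dvd_gT (g : gT) : (#[g]%g %| #|gT|)%N by rewrite -cardsT order_dvdG ?inE.
exists (totient r * a.+1)%N; split; first by rewrite muln_gt0 tr_gt0.
  move=> g p'g; have dvd_g : (#[g]%g %| r)%N.
    by rewrite -(part_pnat_id p'g) partn_dvd //.
  apply/eqP; rewrite -{2}[g]expg1 eq_expg_mod_order.
  have: (p ^ (totient r * a.+1) == 1 %[mod r])%N.
    rewrite expnM -modnXm Euler_exp_totient ?modnXm ?exp1n //.
  rewrite !eqn_mod_dvd ?expn_gt0 ?prime_gt0 //; exact: dvdn_trans.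
move=> g u pu; apply: contraNneq => gu.
have: (#[u]%g %| r)%N.
  rewrite order_dvdn -gu -expgM -order_dvdn (dvdn_trans (dvd_gT g)) //.
  rewrite -[X in (X %| _)%N](partnC p) // dvdn_mul // p_part dvdn_exp2l //.
  by rewrite -/a (leq_trans (leqnSn a)) // leq_pmull.
move=> ur; rewrite -order_eq1 -dvdn1 -(eqP (_ : gcdn #[u]%g r == 1%N)).
  by rewrite dvdn_gcd dvdnn.
by apply: pnat_coprime pu (part_pnat _ _).
Qed.

(** * Central idempotents at [p]-singular elements *)

Section CentralIdempotent.
Variables (p : nat) (k : fieldType) (gT : finGroupType) (b : galg k gT).
Hypothesis pk : p \in [pchar k].
Hypothesis cb : forall x, b * x = x * b.
Hypothesis bb : b * b = b.

Lemma central_conj g h : b (g ^ h)%g = b g.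
Proof.
have := congr1 (fun x : galg k gT => x (g * h)%g) (cb (galg_of k h)).
by rewrite mul_galg_of galg_of_mul mulgK conjgE => ->.
Qed.

Lemma central_idem_exp x n : (0 < n)%N -> (b * x) ^+ n = b * x ^+ n.
Proof.
case: n => // n _; rewrite exprMn_comm; last exact: cb.
congr (_ * _); elim: n => // n IHn; by rewrite exprS IHn.
Qed.

(* Osima's theorem *)
Lemma central_idem_p_singular g : (p %| #[g]%g)%N -> b g = 0.
Proof.
move=> pg; have pr_p := pcharf_prime pk.
have [n [n_gt0 reg_n no_root]] := exists_p_regular_power gT pr_p.
set u := (g.`_p)%g; set s := (g.`_p^')%g.
have Dg : (u * s)%g = g by apply: consttC.
have us : commute u s by apply: (centsP (cycle_abelian g)); apply: mem_cycle.
have u1 : u != 1%g.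
  apply: contraTneq pg => /constt1P; rewrite /p_elt p'natE ?order_gt0 //.
(* The coefficient [b (u s)] is that of [b s^-1] at the [p]-element [u], and [b s^-1] is fixed by
   the [p^n]-th power. *)
rewrite -Dg -(invgK s) -mul_galg_of.
apply: (coef_p_element_eq0 (n := n) pk) => [||h|h].
- exact: p_elt_constt.
- rewrite central_idem_exp ?expn_gt0 ?prime_gt0 // -galg_ofX reg_n //.
  by rewrite p_eltV p_elt_constt.
- rewrite !mul_galg_of invgK -[in RHS](central_conj _ u) conjMg.
  by rewrite (_ : s ^ u = s)%g // conjgE -us mulKg.
by apply: no_root => //; apply: p_elt_constt.
Qed.

End CentralIdempotent.

(** * Relative traces and the coefficients of a block *)

Section BlockMatrixUnits.
Variables (p : nat) (k : fieldType) (gT : finGroupType) (b : galg k gT).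
Hypothesis pk : p \in [pchar k].
Hypothesis cb : forall x, b * x = x * b.
Hypothesis bb : b * b = b.
Variables (m : nat) (e x : galg k gT) (u v : 'I_m -> galg k gT).
Hypotheses (eu : forall i, e * u i = u i) (ve : forall i, v i * e = v i).
Hypothesis uv : forall i j, u i * v j = if i == j then e else 0.
Hypotheses (sum_vu : \sum_i v i * u i = b) (eb : e * b = e).
Hypotheses (e0 : e != 0) (ee : e * e = e).
Hypotheses (ex : e * x = x) (xe : x * e = x) (xx : x * x = 0).
Hypothesis gen : forall y, exists c d, e * y * e = c *: e + d *: x.
Implicit Types (y z : galg k gT) (g h : gT).
Local Notation t := (@unit_coef k gT).

Definition conj_sum y : galg k gT := \sum_g galg_of k g * y * galg_of k g^-1.

(** By Cauchy, some [c] of order [p] centralizes [h]. The summands [y (g^-1 h g)] are unchanged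
    under [g |-> c g], which has no fixed point. *)
Lemma conj_sum_eq0 y h : (p %| #|'C[h]%g|)%N -> conj_sum y h = 0.
Proof.
case/(Cauchy (pcharf_prime pk)) => c /cent1P ch oc; rewrite sum_ffunE.
apply: (@sum_iter_invariant p _ _ (mulg c) 1 _ pk) => g.
- have iterE n : iter n (mulg c) g = (c ^+ n * g)%g.
    by elim: n => [|n IHn]; rewrite ?mul1g // iterS IHn expgS mulgA.
  by rewrite expn1 iterE -oc expg_order mul1g.
- rewrite !mul_galg_of !galg_of_mul !invgK invMg; congr (y _).
  by rewrite -!mulgA (mulgA h c) -ch -mulgA mulKg.
move/(canRL (mulgK g)); rewrite mulgV => c1.
by have := prime_gt1 (pcharf_prime pk); rewrite -oc c1 order1.
Qed.

(** The hypothesis provides dual families [a1, a2] and [b1, b2] of the corner. Expand [e g^-1]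
    through [b = sum_i v_i u_i]; the sum over [g] then collapses by [galg_dual_sum]. *)
Lemma conj_sum_corner (a1 b1 a2 b2 : galg k gT) :
    (forall y, e * y * e = t (y * a1) *: b1 + t (y * a2) *: b2) ->
  conj_sum e = \sum_i v i * (a1 * b1 + a2 * b2) * u i.
Proof.
move=> dual; rewrite /conj_sum.
have eg g : e * galg_of k g^-1 = \sum_i
    (t (galg_of k g^-1 * (v i * a1)) *: b1 + t (galg_of k g^-1 * (v i * a2)) *:
      b2) * u i.
  rewrite -{1}eb -mulrA cb mulrA -sum_vu mulr_sumr; apply: eq_bigr => i _.
  by rewrite !mulrA -dual -!mulrA eu.
under eq_bigr => g _ do rewrite -mulrA eg mulr_sumr.
rewrite exchange_big; apply: eq_bigr => i _ /=.
rewrite mulrDr mulrDl !mulrA -[v i * a1]galg_dual_sum -[v i * a2]galg_dual_sum.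
rewrite !mulr_suml -big_split; apply: eq_bigr => g _ /=.
by rewrite !galg_dual_sum mulrDl mulrDr -!scalerAl -!scalerAr !mulrA.
Qed.

Lemma unit_coef_corner_neq0 z : z != 0 -> e * z * e = z ->
  exists y, t (e * y * e * z) != 0.
Proof.
move=> /unit_coef_nondeg[g tg] ez; exists (galg_of k g).
apply: contraNneq tg => tz; rewrite -ez -!mulrA unit_coef_sym -!mulrA.
by rewrite unit_coef_sym -!mulrA in tz *; rewrite -tz.
Qed.

(** Here [e / t e] is dual to [e], so the relative trace of [e] is [b / t e]. *)
Lemma block_coef_trivial_corner g : x = 0 -> (p %| #|'C[g]%g|)%N -> b g = 0.
Proof.
move=> x0 /(conj_sum_eq0 e); have te : t e != 0.
  have [|y] := @unit_coef_corner_neq0 e e0; first by rewrite !ee.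
  have [c [d ->]] := gen y; rewrite x0 scaler0 addr0 -scalerAl ee linearZ /=.
  by rewrite mulf_eq0 => /norP[].
rewrite (@conj_sum_corner ((t e)^-1 *: e) e 0 0) => [|y].
  rewrite mul0r addr0 -scalerAl ee.
  under eq_bigr => i _ do rewrite -scalerAr -scalerAl ve.
  rewrite -scaler_sumr sum_vu ffunE => bg; have /eqP : (t e)^-1 * b g = 0 := bg.
  by rewrite mulf_eq0 invr_eq0 (negPf te) => /eqP.
have tye : t (y * e) = t (e * y * e).
  by rewrite -{1}ee mulrA unit_coef_sym mulrA.
rewrite scaler0 addr0 -scalerAr linearZ /= tye.
by have [c [d ->]] := gen y;
  rewrite x0 scaler0 addr0 linearZ /= mulrCA mulVf ?mulr1.
Qed.

Section DualNumbersCorner.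
Hypothesis x0 : x != 0.
Local Notation X := (\sum_i v i * x * u i).

Lemma unit_coef_nilpotent_neq0 : t x != 0.
Proof.
have [|y] := @unit_coef_corner_neq0 x x0; first by rewrite ex xe.
have [c [d ->]] := gen y;
  rewrite mulrDl -!scalerAl ex xx scaler0 addr0 linearZ /=.
by rewrite mulf_eq0 => /norP[].
Qed.

Let tx0 := unit_coef_nilpotent_neq0.

(** Pairing [e y e = c e + d x] with [x] gives [c], since [x^2 = 0]; pairing with [e] then gives
    [d]. *)
Lemma corner_coords y : e * y * e =
  (t (y * x) / t x) *: e + ((t (y * e) - t (y * x) / t x * t e) / t x) *: x.
Proof.
have tye z : e * z = z -> z * e = z -> t (y * z) = t (e * y * e * z).
  by move=> ez ze; rewrite -[X in t (_ * X)]ze mulrA unit_coef_sym !mulrA -[in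
    RHS]mulrA ez.
have [c [d yE]] := gen y; rewrite (tye x) // (tye e) // yE !mulrDl -!scalerAl.
rewrite ex xx xe ee scaler0 addr0 !linearD !linearZ /= mulfK //.
by rewrite -mulrDl addrAC subrr add0r mulfK.
Qed.

(** The family dual to [e, x] is [x / t x] and [a2]; each of the two products with its partner is
    [x / t x], whence the factor 2. *)
Lemma conj_sum_socle : conj_sum e = (2%:R / t x) *: X.
Proof.
pose a2 := (t x)^-1 *: (e - (t e / t x) *: x).
rewrite (@conj_sum_corner ((t x)^-1 *: x) e a2 x) => [|y]; last first.
  rewrite corner_coords /a2 -!scalerAr mulrBr -scalerAr !linearZ /=.
  rewrite linearD linearZ linearN /= mulrN; congr (_ *: _ + _ *: _);
    first by rewrite mulrC.
  by rewrite [RHS]mulrC; congr ((_ - _) / _); rewrite [RHS]mulrC mulrA mulrAC.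
rewrite scaler_sumr; apply: eq_bigr => i _.
rewrite /a2 -!scalerAl mulrBl -scalerAl xx ex xe scaler0 subr0 -scalerDl.
by rewrite -scalerAr -scalerAl mulrDl mul1r.
Qed.

Lemma socle_coef_eq0 g : 2%:R != 0 :> k -> (p %| #|'C[g]%g|)%N -> X g = 0.
Proof.
move=> two0 /(conj_sum_eq0 e); rewrite conj_sum_socle ffunE => Xg.
have /eqP : (2%:R / t x) * X g = 0 := Xg.
by rewrite !mulf_eq0 invr_eq0 (negPf two0) (negPf tx0) => /eqP.
Qed.

(** A copy of the matrix algebra over [k]. Together with [X], which commutes with it and squares to
    zero, it presents the block as dual numbers over matrices. *)
Definition scalar_mx_sum (a : 'M[k]_m) : galg k gT :=
  \sum_i \sum_j a i j *: (v i * u j).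

Lemma scalar_mx_sumM a a' :
  scalar_mx_sum a * scalar_mx_sum a' = scalar_mx_sum (a *m a').
Proof.
rewrite /scalar_mx_sum mulr_suml; apply: eq_bigr => i _.
transitivity (\sum_j \sum_l (a i j * a' j l) *: (v i * u l)); last first.
  rewrite exchange_big; apply: eq_bigr => l _.
  by rewrite mxE scaler_suml.
rewrite mulr_suml; apply: eq_bigr => j _; rewrite mulr_sumr (bigD1 j) //=.
rewrite [X in _ + X]big1 => [|l lj].
  rewrite addr0 mulr_sumr; apply: eq_bigr => l _.
  by rewrite -scalerAr -scalerAl scalerA mulrA -[_ * u j * v j]mulrA uv eqxx ve
    mulrC.
rewrite mulr_sumr big1 // => l' _.
rewrite -scalerAr -scalerAl mulrA -[_ * u j * v l]mulrA uv eq_sym (negPf lj).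
by rewrite mulr0 mul0r !scaler0.
Qed.

Lemma socle_mulv i : X * v i = v i * x.
Proof.
rewrite mulr_suml (bigD1 i) //= big1 => [|j ji].
  by rewrite -mulrA uv eqxx addr0 -mulrA xe.
by rewrite -mulrA uv (negPf ji) mulr0.
Qed.

Lemma socle_mulu i : u i * X = x * u i.
Proof.
rewrite mulr_sumr (bigD1 i) //= big1 => [|j ji].
  by rewrite !mulrA uv eqxx addr0 ex.
by rewrite !mulrA uv eq_sym (negPf ji) !mul0r.
Qed.

Lemma socle_comm a : GRing.comm (scalar_mx_sum a) X.
Proof.
have [Xv uX] := (socle_mulv, socle_mulu); move: X Xv uX => Y Yv uY.
rewrite /GRing.comm /scalar_mx_sum mulr_suml mulr_sumr; apply: eq_bigr => i _.
rewrite mulr_suml mulr_sumr; apply: eq_bigr => j _.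
by rewrite -scalerAl -scalerAr -mulrA uY !mulrA Yv.
Qed.

Lemma socle_sq : X * X = 0.
Proof.
rewrite {2}(eq_bigr (fun i => v i * (x * u i))) => [|i _];
  last by rewrite mulrA.
by rewrite mulr_sumr big1 // => i _;
  rewrite !mulrA socle_mulv -[_ * x * x]mulrA xx mulr0 mul0r.
Qed.

(** Both traces are multiples of the matrix trace: [tr(a) t(e)] and [tr(a) t(x)]. *)
Lemma unit_coef_scalar_mx a :
  t x * t (scalar_mx_sum a) = t e * t (X * scalar_mx_sum a).
Proof.
have trE (c : 'I_m -> 'I_m -> k) s : (forall i j, c i j = if i == j then s else
  0) ->
    \sum_i \sum_j a i j * c i j = \tr a * s.
  move=> cE; rewrite mulr_suml; apply: eq_bigr => i _.
  rewrite (bigD1 i) //= big1 => [|j ji]; first by rewrite cE eqxx addr0.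
  by rewrite cE eq_sym (negPf ji) mulr0.
have Xv := socle_mulv; move: X Xv => Y Yv.
have -> : t (scalar_mx_sum a) = \tr a * t e.
  rewrite -(@trE (fun i j => t (v i * u j))) => [|i j].
    rewrite linear_sum; apply: eq_bigr => i _; rewrite linear_sum.
    by apply: eq_bigr => j _; rewrite linearZ.
  by rewrite unit_coef_sym uv eq_sym; case: eqP => // _; rewrite linear0.
have -> : t (Y * scalar_mx_sum a) = \tr a * t x.
  rewrite -(@trE (fun i j => t (v i * x * u j))) => [|i j].
    rewrite mulr_sumr linear_sum; apply: eq_bigr => i _;
      rewrite mulr_sumr linear_sum.
    by apply: eq_bigr => j _; rewrite -scalerAr mulrA Yv linearZ.
  rewrite unit_coef_sym mulrA uv eq_sym; case: eqP => _; first by rewrite ex.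
  by rewrite mul0r linear0.
by rewrite mulrCA [t x * _]mulrC mulrCA.
Qed.

(** [S] is the sum of the [M0^i M1 M0^(r-1-i)], whose summands have equal trace against [Y M0^s] by
    cyclicity. The parameter [s] carries the induction; at [r = 0] the truncated predecessor is
    harmless. *)
Lemma dual_number_pow (Y M0 M1 : galg k gT) r :
    GRing.comm M0 Y -> GRing.comm M1 Y -> Y * Y = 0 ->
  exists S, [/\ (M0 + Y * M1) ^+ r = M0 ^+ r + Y * S, GRing.comm S Y
    & forall s, t (Y * S * M0 ^+ s) = t (Y * M0 ^+ (r + s).-1 * M1) *+ r].
Proof.
move=> c0 c1 YY; elim: r => [|r [S [powE cS tS]]].
  by exists 0; split=> [||s];
    rewrite ?mulr0 ?addr0 ?mul0r ?linear0 // /GRing.comm mulr0 mul0r.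
have cP n : GRing.comm (M0 ^+ n) Y by apply/commr_sym/commrX/commr_sym.
exists (S * M0 + M0 ^+ r * M1); split.
- rewrite exprSr powE mulrDl !mulrDr -exprSr -addrA; congr (_ + _).
  rewrite [M0 ^+ r * _]mulrA cP -!mulrA [S * (Y * _)]mulrA cS -mulrA [Y * (Y *
    _)]mulrA YY.
  by rewrite mul0r addr0 addrC.
- by apply/commr_sym/commrD; apply: commrM => //; apply: commr_sym.
move=> s; rewrite mulrDr mulrDl linearD /= mulrA -[_ * M0 * _]mulrA -exprS tS.
rewrite mulrSr addnS /=; congr (_ *+ _ + _).
rewrite unit_coef_sym !mulrA cP -[_ * M0 ^+ s * _]mulrA -exprD addnC //.
Qed.

(** Write [y = M0 + X M1]. Then [y = y^(p^n) = M0^(p^n) + X S] with [t (X S) = 0], so both traces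
    only see the scalar matrix [M0^(p^n)]. *)
Lemma unit_coef_frobenius_fixed n y : (0 < n)%N -> b * y = y ->
  y ^+ (p ^ n) = y -> t x * t y = t e * t (X * y).
Proof.
(* [al] and [be] are the coordinates of [u_i y v_j] along [e] and [x], from [corner_coords]. *)
move=> n_gt0 by_ yq; pose al i j := t (u i * y * v j * x) / t x.
pose be i j := (t (u i * y * v j * e) - al i j * t e) / t x.
pose A0 : 'M_m := \matrix_(i, j) al i j;
  pose A1 : 'M_m := \matrix_(i, j) be i j.
pose M0 := scalar_mx_sum A0; pose M1 := scalar_mx_sum A1.
have Xv := socle_mulv; have cX := socle_comm; have XX := socle_sq.
have tX a := unit_coef_scalar_mx a; move: X Xv cX XX tX => Y Yv cY YY tY.
have yE : y = M0 + Y * M1.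
  have yb : y * b = y by rewrite -cb.
  rewrite /M1 /scalar_mx_sum mulr_sumr -big_split.
  rewrite -[LHS]yb -[in LHS]by_ -{1}sum_vu !mulr_suml; apply: eq_bigr => i _.
  rewrite [Y * _]mulr_sumr -big_split -[in LHS]sum_vu mulr_sumr.
  apply: eq_bigr => j _ /=; rewrite !mxE -scalerAr [Y * _]mulrA Yv.
  transitivity (v i * (e * (u i * y * v j) * e) * u j).
    by rewrite !mulrA ve -!mulrA eu.
  rewrite corner_coords -/(al i j) -/(be i j) mulrDr mulrDl -!scalerAr
    -!scalerAl.
  by rewrite ve.
have [S [powE cS tS]] := dual_number_pow (p ^ n)%N (cY A0) (cY A1) YY.
(* This trace is a multiple of [p^n], and [n > 0]. *)
have tYS : t (Y * S) = 0.
  have := tS 0%N; rewrite expr0 mulr1 => ->.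
  by rewrite -(prednK n_gt0) expnS mulrnA (mulrn_pchar pk) mul0rn.
have [a Da] : exists a, scalar_mx_sum A0 ^+ (p ^ n) = scalar_mx_sum a.
  rewrite -(prednK (_ : 0 < p ^ n)%N) ?expn_gt0 ?prime_gt0 ?(pcharf_prime pk)
    //.
  elim: (p ^ n).-1%N => [|r [a Da]]; first by eexists; apply: expr1.
  by eexists; rewrite exprS Da; apply: scalar_mx_sumM.
have yE' : y = scalar_mx_sum a + Y * S by rewrite -yq [in LHS]yE powE Da.
by rewrite yE' mulrDr mulrA YY mul0r addr0 linearD /= tYS addr0 tY.
Qed.

End DualNumbersCorner.

(** In the main case [x != 0] with [g] [p]-regular, [y = b g^-1] yields [t(x) b(g) = t(e) X(g)], and
    [X(g)] vanishes. *)
Lemma block_coef_eq0 g :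
  x = 0 \/ 2%:R != 0 :> k -> (p %| #|'C[g]%g|)%N -> b g = 0.
Proof.
have [x0 _ | x0 [x_0 | two0] pC] := eqVneq x 0;
  first exact: block_coef_trivial_corner.
  by case/eqP: x0.
have [pg | p'g] := boolP (p %| #[g]%g)%N;
  first exact: central_idem_p_singular pg.
have pr_p := pcharf_prime pk.
have [n [n_gt0 reg_n _]] := exists_p_regular_power gT pr_p.
have gn : ((g^-1) ^+ (p ^ n))%g = (g^-1)%g.
  by apply: reg_n; rewrite p_eltV /p_elt p'natE ?order_gt0.
pose y := b * galg_of k g^-1.
have byy : b * y = y by rewrite mulrA bb.
have yn : y ^+ (p ^ n) = y.
  by rewrite central_idem_exp ?expn_gt0 ?prime_gt0 // -galg_ofX gn.
have /eqP := unit_coef_frobenius_fixed x0 n_gt0 byy yn.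
have bX : b * (\sum_i v i * x * u i) = \sum_i v i * x * u i.
  rewrite mulr_sumr; apply: eq_bigr => i _; rewrite !mulrA; congr (_ * _ * _).
  rewrite -sum_vu mulr_suml (bigD1 i) //= big1 => [|j ji].
    by rewrite -mulrA uv eqxx addr0.
  by rewrite -mulrA uv (negPf ji) mulr0.
rewrite /y unit_coef_galg_of mulrA -cb bX unit_coef_galg_of.
rewrite socle_coef_eq0 // mulr0 mulf_eq0 (negPf (unit_coef_nilpotent_neq0 x0)).
by move/eqP.
Qed.

End BlockMatrixUnits.

(** * The trace form of a block algebra *)

Section BlockAlgebra.
Variables (k : fieldType) (gT : finGroupType) (b : galg k gT).
Hypothesis hb : block_idempotent b.
Local Notation B := (subvs_of (block_algebra hb)).

Lemma block_idem_idem : b * b = b. Proof. by case: hb. Qed.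

Lemma block_idem_central x : b * x = x * b.
Proof. by case: hb => /memv_capP[_ /centvP cb] _ _ _; rewrite cb ?memvf. Qed.

Lemma memv_block x : (x \in block_algebra hb) = (x * b == x).
Proof.
rewrite /= -limg_amulr; apply/memv_imgP/eqP => [[y _ ->] | xb].
  by rewrite lfunE /= -mulrA block_idem_idem.
by exists x; rewrite ?memvf // lfunE.
Qed.

Lemma block_algid : algid (block_algebra hb) = b.
Proof.
have Bb : b \in block_algebra hb by rewrite memv_block block_idem_idem.
apply: etrans (algidr Bb); apply/esym; rewrite block_idem_central; apply/eqP.
by rewrite -memv_block memv_algid.
Qed.

Lemma block_coef_sym (y z : B) :
  unit_coef (vsval (y * z)) = unit_coef (vsval (z * y)).
Proof. exact: unit_coef_sym. Qed.

(** A group element that detects [y] may be multiplied by [b] to land in the block. *)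
Lemma block_coef_nondeg (y : B) :
  y != 0 -> exists z : B, unit_coef (vsval (y * z)) != 0.
Proof.
move=> y0; have [|g yg] := @unit_coef_nondeg _ _ (vsval y).
  by apply: contraNneq y0 => y0; apply/eqP/val_inj.
have Bg : galg_of k g * b \in block_algebra hb.
  by rewrite memv_block -mulrA block_idem_idem.
exists (Subvs Bg); rewrite /= -block_idem_central mulrA.
suff /eqP -> : vsval y * b == vsval y by [].
by rewrite -memv_block subvsP.
Qed.

End BlockAlgebra.

Local Close Scope ring_scope.

Theorem theorem1p2 (p : nat) (k : closedFieldType) (gT : finGroupType)
    (b : galg k gT) (hb : block_idempotent b) (P : {group gT}) :
  prime p -> p \in [pchar k]%R ->
  defect_group p b P -> P :!=: 1%g ->
  unique_simple_module (subvs_of (block_algebra hb)) ->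
  2 <= \dim {: HH1 (subvs_of (block_algebra hb))}.
Proof.
move=> pr_p pk /maxgroupp/andP[pP brP] P1 one_simple.
pose t : {scalar subvs_of (block_algebra hb)} := @unit_coef k gT \o vsval.
have [|[m [e [x [u [v [[e0 ee] [eu ve uv sum_vu] [ex xe] [xx x0] gen]]]]]]] :=
  @one_simple_cases _ _ t (@block_coef_sym _ _ _ hb) (@block_coef_nondeg _ _ _
    hb) one_simple.
  exact: leq_dim_HH1.
have [g Pg bg] : exists2 g, g \in 'C(P)%g & (b g != 0)%R.
  have [g bg | b0] := pickP (fun g => (brauer P b g != 0)%R).
    by exists g; move: bg; rewrite ffunE; case: ifP; rewrite ?eqxx.
  by case/eqP: brP; apply/ffunP => g; rewrite [RHS]ffunE; apply/eqP/negbFE/b0.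
have Bb (y : subvs_of (block_algebra hb)) : (vsval y * b = vsval y)%R.
  by apply/eqP; rewrite -memv_block subvsP.
have ebE : (b * vsval e = vsval e)%R by rewrite (block_idem_central hb) Bb.
(* The matrix units of the block are read in the whole group algebra, where they sum to [b] instead
   of [1]. *)
case/eqP: bg; apply: (block_coef_eq0 pk (block_idem_central hb)
  (block_idem_idem hb)
  (e := vsval e) (x := vsval x) (u := vsval \o u) (v := vsval \o v)) => /=.
- by move=> i; exact: (congr1 vsval (eu i)).
- by move=> i; exact: (congr1 vsval (ve i)).
- by move=> i j; have := congr1 vsval (uv i j); case: eqP.
- by have := congr1 vsval sum_vu; rewrite linear_sum /= block_algid.
- exact: Bb.
- by [].
- exact: (congr1 vsval ee).
- exact: (congr1 vsval ex).
- exact: (congr1 vsval xe).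
- exact: (congr1 vsval xx).
(* [e y e = e (b y b) e] replaces an arbitrary [y] by an element of the block. *)
- move=> y; have By : (b * y * b)%R \in block_algebra hb.
    by rewrite memv_block -!mulrA (block_idem_idem hb).
  have [c [d /(congr1 vsval) /=]] := gen (Subvs By);
    rewrite !mulrA Bb -mulrA ebE.
  by exists c, d.
- by case: x0 => [->|]; [left | right].
(* [P] is nontrivial and centralizes [g], so [p] divides the order of [P], which divides that of the
   centralizer of [g]. *)
have [_ pP' _] := pgroup_pdiv pP P1; apply: dvdn_trans pP' (cardSg _).
by rewrite sub_cent1.
Qed.
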